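(* Let $d \geq 2$ and let $\Phi \colon \mathbb{D}^d \to \mathbb{D}^d$ be a truly $d$-dimensional symbol of the form $$\Phi(z_1, z_2, \ldots, z_d) = \big(\phi(z_1), \psi(z_2, \ldots, z_d)\big),$$ with $\phi \colon \mathbb{D} \to \mathbb{D}$ and $\psi \colon \mathbb{D}^{d-1} \to \mathbb{D}^{d-1}$. If $\|\phi\|_\infty = 1$, then $\beta_d(C_\Phi) = 1$, that is, $\lim_{n\to\infty} [a_{n^d}(C_\Phi)]^{1/n}$ exists and equals $1$.
   Context: $\mathbb{D}$ is the open unit disk of $\mathbb{C}$. $H^2(\mathbb{D}^d)$ is the Hardy space of holomorphic functions $f(z) = \sum_{\alpha\in\mathbb{N}^d} a_\alpha z^\alpha$ on $\mathbb{D}^d$ with $\|f\|^2 = \sum_\alpha |a_\alpha|^2 < \infty$. An analytic map $\Phi\colon\mathbb{D}^d\to\mathbb{D}^d$ is a symbol if the composition operator $C_\Phi\colon H^2(\mathbb{D}^d)\to H^2(\mathbb{D}^d)$, $C_\Phi f = f\circ\Phi$, is bounded; it is truly $d$-dimensional if $\Phi(\mathbb{D}^d)$ has non-void interior. $\|\phi\|_\infty = \sup_{z\in\mathbb{D}}|\phi(z)|$. For a bounded operator $T$ on a Hilbert space, the approximation numbers are $a_n(T) = \inf_{\mathrm{rank}\,R<n}\|T-R\|$, $n\geq 1$; $\beta_d^-(T) = \liminf_{n} [a_{n^d}(T)]^{1/n}$, $\beta_d^+(T) = \limsup_n [a_{n^d}(T)]^{1/n}$, and one writes $\beta_d(T)$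 for the common value in case of equality. *)

(* Defs.v *)
(* MathComp / MathComp-Analysis; the complex field is R[i] for R : realType. *)
From HB Require Import structures.
From mathcomp Require Import all_boot all_order all_algebra.
From mathcomp Require Import finmap.
From mathcomp Require Import all_classical all_reals all_analysis.
From mathcomp Require Import complex.

Set Implicit Arguments.
Unset Strict Implicit.
Unset Printing Implicit Defensive.

Import Order.TTheory GRing.Theory Num.Theory.
Import numFieldNormedType.Exports.

Local Open Scope classical_set_scope.
Local Open Scope ring_scope.

(* MathComp-Analysis gives the normed module structure over itself to abstract
   numeric fields only; this transports it to the concrete type R[i]. *)
HB.instance Definition _ (R : realType) := NormedModule.copy R[i] R[i]^o.

(* The R-valued modulus; `|z| itself lives in R[i]. *)
Notation cabs := ComplexField.Normc.normc.

(** Unit disc and polydisc, as types of points *)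

Definition disc (R : realType) : Type := {z : R[i] | cabs z < 1}.

Definition polydisc (R : realType) (d : nat) : Type :=
  {z : 'rV[R[i]]_d | [forall j, cabs (z ord0 j) < 1]}.

Definition pcons_row (R : realType) (m : nat) (u : disc R) (v : polydisc R m) :
    'rV[R[i]]_m.+1 :=
  row_mx (const_mx (val u) : 'rV_1) (val v).

Lemma pcons_subproof (R : realType) (m : nat) (u : disc R) (v : polydisc R m) :
  [forall j, cabs (pcons_row u v ord0 j) < 1].
Proof.
apply/forallP => j; rewrite mxE; case: splitP => k _.
  by rewrite mxE (valP u).
by have /forallP := valP v; apply.
Qed.

(* (u, (v_1, ..., v_m)) |-> (u, v_1, ..., v_m); every point of the polydisc of
   dimension m.+1 has this form, in exactly one way. *)
Definition pcons (R : realType) (m : nat) (u : disc R) (v : polydisc R m) :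
    polydisc R m.+1 :=
  exist _ (pcons_row u v) (pcons_subproof u v).

(** Holomorphy *)

(* Extension by 0. The polydisc is open, so the values outside are irrelevant
   to differentiability inside. *)
Definition extend0 (R : realType) (d : nat) (f : polydisc R d -> R[i])
    (z : 'rV[R[i]]_d) : R[i] :=
  if insub z is Some w then f w else 0.

(* [differentiable] is over the scalar field R[i], so it is complex
   differentiability. *)
Definition holomorphic (R : realType) (d : nat) (f : polydisc R d -> R[i]) :
    Prop :=
  forall z : polydisc R d, differentiable (extend0 f) (val z).

Definition analytic_map (R : realType) (d : nat)
    (Phi : polydisc R d -> polydisc R d) : Prop :=
  forall j : 'I_d, holomorphic (fun z => val (Phi z) ord0 j).

(** The Hardy space H^2 of the polydisc *)

(* Unordered summation: convergence along the directed set of finite subsets. *)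
Definition has_sum (R : realType) (I : choiceType) (x : I -> R[i]) (s : R[i]) :
    Prop :=
  forall e : R, 0 < e -> exists A : {fset I}, forall B : {fset I},
    (A `<=` B)%fset -> cabs (\sum_(i <- B) x i - s) < e.

Definition monomial (R : realType) (d : nat) (alpha : {ffun 'I_d -> nat})
    (z : polydisc R d) : R[i] :=
  \prod_(j < d) val z ord0 j ^+ alpha j.

Definition is_power_series (R : realType) (d : nat) (f : polydisc R d -> R[i])
    (a : {ffun 'I_d -> nat} -> R[i]) : Prop :=
  forall z, has_sum (fun alpha => a alpha * monomial alpha z) (f z).

Definition sqsum (R : realType) (d : nat) (a : {ffun 'I_d -> nat} -> R[i]) :
    \bar R :=
  \esum_(alpha in [set: {ffun 'I_d -> nat}]) (cabs (a alpha) ^+ 2)%:E.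

(* The sum of a power series converging on the whole polydisc is holomorphic
   there, so holomorphy need not be required separately. *)
Definition hardy (R : realType) (d : nat) : set (polydisc R d -> R[i]) :=
  [set f | exists2 a, is_power_series f a & (sqsum a < +oo)%E].

(* The power series coefficients of f, which are unique when they exist. *)
Definition coeffs (R : realType) (d : nat) (f : polydisc R d -> R[i]) :
    {ffun 'I_d -> nat} -> R[i] :=
  xget (fun=> 0) [set a | is_power_series f a].

Definition hardy_norm (R : realType) (d : nat) (f : polydisc R d -> R[i]) : R :=
  Num.sqrt (fine (sqsum (coeffs f))).

(** Bounded operators and approximation numbers *)

(* The normed space is given as a set H of vectors of an ambient space V
   together with a function N which is a norm on H; only the values on H of an
   operator V -> V are ever used. *)
Section Operators.
Variables (R : realType) (V : lmodType R[i]) (H : set V) (N : V -> R).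
Implicit Types (T S : V -> V) (f g : V).

Definition bounded_operator T : Prop :=
  [/\ forall f, H f -> H (T f),
      forall (c : R[i]) f g, H f -> H g -> T (c *: f + g) = c *: T f + T g &
      exists M : R, forall f, H f -> N (T f) <= M * N f].

Definition opnorm T : R := sup [set N (T f) | f in [set f | H f /\ N f <= 1]].

(* T maps H into the span of fewer than n vectors. *)
Definition rank_lt T (n : nat) : Prop :=
  exists2 k : nat, (k < n)%N & exists e : 'I_k -> V,
    forall f, H f -> exists c : 'I_k -> R[i], T f = \sum_(j < k) c j *: e j.

Definition approx_num T (n : nat) : R :=
  inf [set opnorm (fun f => T f - S f) |
         S in [set S | bounded_operator S /\ rank_lt S n]].

(* n |-> [a_{n^d}(T)]^{1/n}; the term n = 0 is a junk value, irrelevant to the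
   limits below. *)
Definition beta_seq (d : nat) T (n : nat) : R :=
  approx_num T (n ^ d)%N `^ n%:R^-1.

Definition beta_minus (d : nat) T : \bar R :=
  limn_einf (fun n => (beta_seq d T n)%:E).

Definition beta_plus (d : nat) T : \bar R :=
  limn_esup (fun n => (beta_seq d T n)%:E).

End Operators.

(** Composition operators *)

Definition comp_op (R : realType) (d : nat) (Phi : polydisc R d -> polydisc R d)
    (f : polydisc R d -> R[i]) : polydisc R d -> R[i] :=
  f \o Phi.

Definition is_symbol (R : realType) (d : nat)
    (Phi : polydisc R d -> polydisc R d) : Prop :=
  analytic_map Phi /\
  bounded_operator (@hardy R d) (@hardy_norm R d) (comp_op Phi).

Definition truly_dimensional (R : realType) (d : nat)
    (Phi : polydisc R d -> polydisc R d) : Prop :=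
  interior (range (fun z => val (Phi z)) : set 'rV[R[i]]_d) !=set0.

Definition sup_norm (R : realType) (phi : disc R -> disc R) : R :=
  sup (range (fun z => cabs (val (phi z)))).

(* Main.v *)
Require Import Defs.
From HB Require Import structures.
From mathcomp Require Import all_boot all_order all_algebra.
From mathcomp Require Import finmap.
From mathcomp Require Import all_classical all_reals all_analysis.
From mathcomp Require Import complex ring lra zify.
From mathcomp Require Import separable cyclic cyclotomic.

(** The upper bound is immediate, as the approximation numbers are at most the
    norm of [C_Phi].  The lower bound rests on test functions that are almost
    biorthogonal to point evaluations.  Suppose that there are [N] points [z_i] of
    the polydisc and [N] functions [F_i] of norm at most [C] such that [F_i] is
    close to the Kronecker symbol at the points [Phi(z_l)].  If [S] has rank less
    than [N], the matrix of the values of [S F_i] at [z_l] is singular, so it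
    cannot be close to the identity matrix; hence [a_N(C_Phi)] is at least of the
    order of [1 / (N C K)], where [K] bounds the evaluations at the [z_l]
    (approx_num_comp_ge).  Factors that are subexponential in [n] disappear when
    [n]-th roots are taken, so it remains to find [n ^ d] points in a fixed compact
    part of the polydisc whose test functions have norm at most [E ^ (n / k)], with
    [k] arbitrarily large and [E] independent of [k] (root_limit1).

    As [Phi] splits, the points and the functions may be taken as products
    (hardy_tensor), and the two factors play different roles.

    In the first variable about [k ^ m n] points are used, with [m = d - 1].  As
    the modulus of [phi] is continuous with supremum 1, it takes on a compact part
    of the disc all the values [1 - x q ^ l], [l < p s], where [q ^ s = 1/4]; the
    number [p] of factors 4 by which the distance to the unit circle decreases is
    as large as wanted.  The Blaschke products that vanish at all of these image
    points but one are bounded below at the last point by [A ^ - s] with an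
    absolute constant [A], although there are [p s] points: two points whose
    indices differ by [b s] contribute a factor [1 - O(4 ^ - b)], and the product
    of these converges (prod_tau_ge, disc_nodes).  With [p = k ^ d] and [s] about
    [n / k], this is exponential in [n / k] only.  This is where the hypothesis on
    the supremum of [phi] enters.

    In the other variables about [(n / k) ^ m] points are used.  As [Phi] is truly
    [d]-dimensional, the image of [psi] contains a polydisc, and by the Baire
    theorem the image of some compact part of the domain is dense in a smaller
    polydisc (split_dense_image).  Near the points of a grid of roots of unity in
    the latter, products of truncated geometric sums are the test functions, and
    their norms are exponential in [n / k] (grid_nodes).

    The norm of the Hardy space is read off the coefficients of power series.  That
    these are unique is proved by averaging over roots of unity
    (power_series_eq0), and the contractivity of the multiplication by a Blaschke
    factor by a telescoping identity between coefficients (h2_disc_blaschke). *)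

Set Implicit Arguments.
Unset Strict Implicit.
Unset Printing Implicit Defensive.

Import Order.TTheory GRing.Theory Num.Theory.
Import numFieldNormedType.Exports.

Local Open Scope classical_set_scope.
Local Open Scope ring_scope.

(** Completeness and the norm of real matrices are declared separately in the
    hierarchy; the Baire theorem needs their join. *)
HB.instance Definition _ (R : realType) (m n : nat) := Complete.on 'M[R]_(m, n).

(** * Moduli of complex numbers and unordered sums *)

Section Modulus.
Variable R : realType.
Implicit Types x y z : R[i].

Lemma cabs_ge0 x : 0 <= cabs x.
Proof. exact: (@normr_ge0 R (Rcomplex R)). Qed.

Lemma cabs0 : cabs (0 : R[i]) = 0. Proof. exact: ComplexField.Normc.normc0. Qed.

Lemma cabs1 : cabs (1 : R[i]) = 1. Proof. exact: ComplexField.Normc.normc1. Qed.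

Lemma cabsD x y : cabs (x + y) <= cabs x + cabs y.
Proof. exact: le_normcD. Qed.

Lemma cabsN x : cabs (- x) = cabs x. Proof. exact: normcN. Qed.

Lemma cabsM x y : cabs (x * y) = cabs x * cabs y.
Proof. exact: ComplexField.Normc.normcM. Qed.

Lemma cabsV x : cabs x^-1 = (cabs x)^-1.
Proof. exact: ComplexField.Normc.normcV. Qed.

Lemma cabsX x n : cabs (x ^+ n) = cabs x ^+ n.
Proof. by elim: n => [|n IH]; rewrite ?expr0 ?cabs1 // !exprS cabsM IH. Qed.

Lemma cabsC x y : cabs (x - y) = cabs (y - x).
Proof. by rewrite -cabsN opprB. Qed.

Lemma cabsB x y : cabs (x - y) <= cabs x + cabs y.
Proof. by rewrite -(cabsN y) cabsD. Qed.

Lemma cabs_sum (I : Type) (r : seq I) (P : pred I) (F : I -> R[i]) :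
  cabs (\sum_(i <- r | P i) F i) <= \sum_(i <- r | P i) cabs (F i).
Proof. exact: (@ler_norm_sum R (Rcomplex R)). Qed.

Lemma cabs_prod (I : Type) (r : seq I) (P : pred I) (F : I -> R[i]) :
  cabs (\prod_(i <- r | P i) F i) = \prod_(i <- r | P i) cabs (F i).
Proof. by rewrite (big_morph _ cabsM cabs1). Qed.

Lemma cabs_eq0 x : (cabs x == 0) = (x == 0).
Proof.
by apply/eqP/eqP => [/ComplexField.Normc.eq0_normc|->]; last exact: cabs0.
Qed.

Lemma cabs_gt0 x : (0 < cabs x) = (x != 0).
Proof. by rewrite lt_def cabs_ge0 andbT cabs_eq0. Qed.

Lemma cabs_real (t : R) : cabs t%:C%C = `|t|.
Proof. by rewrite /= expr0n /= addr0 sqrtr_sqr. Qed.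

Lemma cabs_conj x : cabs x^*%C = cabs x.
Proof. by case: x => a b /=; rewrite sqrrN. Qed.

Lemma cabs_nat n : cabs (n%:R : R[i]) = n%:R.
Proof.
have -> : (n%:R : R[i]) = (n%:R)%:C%C by rewrite rmorph_nat.
by rewrite cabs_real ger0_norm.
Qed.

Lemma cabs_ler_dist x y : `|cabs x - cabs y| <= cabs (x - y).
Proof. exact: (@ler_dist_dist R (Rcomplex R)). Qed.

Lemma cabsD2_le x y : cabs (x + y) ^+ 2 <= 2 * cabs x ^+ 2 + 2 * cabs y ^+ 2.
Proof.
have := cabsD x y; have := cabs_ge0 (x + y); have := sqr_ge0 (cabs x - cabs y).
nra.
Qed.

Lemma cabsB2_le x y : cabs (x - y) ^+ 2 <= 2 * cabs x ^+ 2 + 2 * cabs y ^+ 2.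
Proof. by rewrite -(cabsN y) cabsD2_le. Qed.

Lemma normr_cabs x : `|x| = (cabs x)%:C%C.
Proof. by rewrite normc_def; case: x. Qed.

Lemma ltr_cabs x (e : R) : (`|x| < e%:C%C) = (cabs x < e).
Proof. by rewrite normr_cabs ltcR. Qed.

Lemma cabs2E z : cabs z ^+ 2 = complex.Re z ^+ 2 + complex.Im z ^+ 2.
Proof. by case: z => x y /=; rewrite sqr_sqrtr // addr_ge0 // sqr_ge0. Qed.

End Modulus.

Arguments ComplexField.Normc.normc : simpl never.

Section UnorderedSums.
Variables (R : realType) (I : choiceType).
Implicit Types (x y : I -> R[i]) (A B : {fset I}).

Lemma fsum_split (V : nmodType) A B (x : I -> V) : (A `<=` B)%fset ->
  \sum_(i <- B) x i = \sum_(i <- A) x i + \sum_(i <- (B `\` A)%fset) x i.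
Proof.
move=> AB; rewrite -big_cat; apply: perm_big; apply: uniq_perm.
- exact: fset_uniq.
- rewrite cat_uniq !fset_uniq andbT /=; apply/hasPn => i.
  by rewrite in_fsetD => /andP[].
- move=> i; rewrite mem_cat in_fsetD.
  by case: (boolP (i \in A)) => //= iA; rewrite (fsubsetP AB).
Qed.

Lemma ler_fsum (A B : {fset I}) (f : I -> R) : (forall i, 0 <= f i) ->
  (A `<=` B)%fset -> \sum_(i <- A) f i <= \sum_(i <- B) f i.
Proof. by move=> f0 /fsum_split ->; rewrite lerDl sumr_ge0. Qed.

Lemma has_sum_ext x y s : x =1 y -> has_sum x s -> has_sum y s.
Proof.
move=> xy h e /h[A hA]; exists A => B /hA.
by under eq_bigr do rewrite xy.
Qed.

Lemma has_sum0 : has_sum (fun=> 0 : R[i]) (0 : R[i]) (I := I).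
Proof. by move=> e e0; exists fset0 => B _; rewrite big1 // subr0 cabs0. Qed.

Lemma has_sumD x y s t : has_sum x s -> has_sum y t ->
  has_sum (fun i => x i + y i) (s + t).
Proof.
move=> hx hy e e0; have e20 : 0 < e / 2 by rewrite divr_gt0.
have [A hA] := hx _ e20; have [B hB] := hy _ e20.
exists (A `|` B)%fset => D; rewrite fsubUset => /andP[AD BD].
rewrite big_split /= opprD addrACA (le_lt_trans (cabsD _ _)) //.
by rewrite (splitr e) ltrD ?hA ?hB.
Qed.

Lemma has_sumZ c x s : has_sum x s -> has_sum (fun i => c * x i) (c * s).
Proof.
move=> hx e e0; have [->|c0] := eqVneq c 0.
  by exists fset0 => B _; rewrite big1 ?mul0r ?subr0 ?cabs0 // => i; rewrite mul0r.
have c_gt0 : 0 < cabs c by rewrite cabs_gt0.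
have [A hA] := hx (e / cabs c) (divr_gt0 e0 c_gt0).
exists A => B /hA; rewrite -mulr_sumr -mulrBr cabsM ltr_pdivlMr // mulrC.
by [].
Qed.

Lemma has_sumB x y s t : has_sum x s -> has_sum y t ->
  has_sum (fun i => x i - y i) (s - t).
Proof.
move=> hx hy; rewrite -(mulN1r t).
apply: has_sum_ext (has_sumD hx (has_sumZ (-1) hy)) => i /=.
by rewrite mulN1r.
Qed.

Lemma has_sum_big (K : finType) (x : K -> I -> R[i]) (s : K -> R[i]) :
  (forall k, has_sum (x k) (s k)) ->
  has_sum (fun i => \sum_k x k i) (\sum_k s k).
Proof.
move=> h.
suff H (r : seq K) : has_sum (fun i => \sum_(k <- r) x k i) (\sum_(k <- r) s k).
  exact: H.
elim: r => [|k r IH].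
  by rewrite big_nil; apply: has_sum_ext has_sum0 => i; rewrite big_nil.
rewrite big_cons; apply: has_sum_ext (has_sumD (h k) IH) => i /=.
by rewrite big_cons.
Qed.

(** Serves to discard, uniformly in [n], the terms that an average over the
    [n]-th roots of unity leaves besides the wanted one. *)
Lemma has_sum_cauchy x s (e : R) : has_sum x s -> 0 < e ->
  exists A, forall B, [disjoint A & B]%fset -> cabs (\sum_(i <- B) x i) < e.
Proof.
move=> hx e0; have [A hA] := hx _ (divr_gt0 e0 (ltr0Sn R 1)).
exists A => B AB; have sAB := fsubsetUl A B.
have -> : \sum_(i <- B) x i =
    (\sum_(i <- (A `|` B)%fset) x i - s) - (\sum_(i <- A) x i - s).
  rewrite opprB addrA subrK (fsum_split _ sAB) addrAC subrr add0r.
  apply: eq_fbigl => i.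
  rewrite in_fsetD in_fsetU; case: (boolP (i \in A)) => //= iA.
  by apply/negbTE; have /fdisjointP := AB; apply.
rewrite (le_lt_trans (cabsB _ _)) // (splitr e) ltrD //; exact: hA.
Qed.

Lemma cabs_le_has_sum x s (K : R) : has_sum x s ->
  (forall B, cabs (\sum_(i <- B) x i) <= K) -> cabs s <= K.
Proof.
move=> hx hK; apply/ler_addgt0Pr => e /hx[A /(_ _ (fsubset_refl A)) hA].
rewrite -[s](subKr (\sum_(i <- A) x i)) (le_trans (cabsB _ _)) //.
by rewrite lerD ?hK // ltW.
Qed.

End UnorderedSums.

(** * Uniqueness of power series coefficients *)

Section RootsOfUnity.
Variable R : realType.

Lemma complex_prim_root_exists n :
  (0 < n)%N -> exists z : R[i], n.-primitive_root z.
Proof.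
move=> n_gt0; have [r] := closed_field_poly_normal ('X^n - 1 : {poly R[i]}).
rewrite (monicP (monicXnsubC 1 n_gt0)) scale1r => rE.
suff /hasP[z _ hz] : has n.-primitive_root r by exists z.
apply: has_prim_root => //.
- by apply/allP => z; rewrite -root_prod_XsubC -rE.
- by rewrite -separable_prod_XsubC -rE separable_Xn_sub_1 // pnatr_eq0 -lt0n.
- by rewrite -ltnS -(size_prod_XsubC r id) -rE size_XnsubC.
Qed.

Lemma cabs_unity_root n (z : R[i]) : (0 < n)%N -> z ^+ n = 1 -> cabs z = 1.
Proof.
move=> n0 zn; apply/eqP; rewrite -(@pexpr_eq1 _ _ n) ?cabs_ge0 //.
by rewrite -cabsX zn cabs1.
Qed.

Lemma sum_unity_root (F : fieldType) (n : nat) (w : F) :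
  w ^+ n = 1 -> \sum_(k < n) w ^+ k = if w == 1 then n%:R else 0.
Proof.
move=> wn; case: eqVneq => [->|w1].
  under eq_bigr do rewrite expr1n.
  by rewrite sumr_const card_ord.
apply: (mulfI (x := w - 1)); first by rewrite subr_eq0.
by rewrite mulr0 -subrX1 wn subrr.
Qed.

End RootsOfUnity.

Section Uniqueness.
Variables (R : realType) (d : nat).
Implicit Types (a b : {ffun 'I_d -> nat} -> R[i]) (al be : {ffun 'I_d -> nat}).

Lemma polydisc_pointP (z : 'rV[R[i]]_d) :
  (forall j, cabs (z ord0 j) < 1) -> exists w : polydisc R d, val w = z.
Proof.
move=> hz; have hz' : [forall j, cabs (z ord0 j) < 1] by apply/forallP.
by exists (exist _ z hz').
Qed.

Lemma is_power_seriesB (f g : polydisc R d -> R[i]) a b :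
  is_power_series f a -> is_power_series g b ->
  is_power_series (f - g) (fun al => a al - b al).
Proof.
move=> hf hg z; apply: has_sum_ext (has_sumB (hf z) (hg z)) => al /=.
by rewrite mulrBl.
Qed.

(** Averaging over the points [w / 2], with [w] running over the [n]-th roots of
    unity in each coordinate, extracts from a power series the terms whose
    exponents have prescribed residues modulo [n]. *)
Lemma unity_root_filter a be (n : nat) : (0 < n)%N ->
  is_power_series (fun=> 0) a ->
  has_sum (fun al => a al * \prod_(j < d) 2^-1 ^+ al j *
                     [forall j, al j == be j %[mod n]]%:R) 0.
Proof.
move=> n0 ha; have [w hw] := complex_prim_root_exists R n0.
have wn : w ^+ n = 1 := prim_expr_order hw.
have w0 : w != 0 by rewrite (prim_root_eq0 hw) -lt0n.
have w1 : cabs w = 1 := cabs_unity_root n0 wn.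
pose pt (k : {ffun 'I_d -> 'I_n}) : 'rV[R[i]]_d := \row_j (2^-1 * w ^+ k j).
have /boolp.choice[p hp] k : exists p : polydisc R d, val p = pt k.
  apply: polydisc_pointP => j; rewrite mxE cabsM cabsX w1 expr1n mulr1 cabsV.
  by rewrite (cabs_nat R 2) invf_lt1 ?ltr1n.
pose c (k : {ffun 'I_d -> 'I_n}) : R[i] :=
  \prod_(j < d) (n%:R^-1 * (w ^- be j) ^+ k j).
have := has_sum_big (fun k : {ffun _ -> _} => has_sumZ (c k) (ha (p k))).
rewrite big1 => [|k _]; last by rewrite mulr0.
apply: has_sum_ext => al.
transitivity (a al * \prod_(j < d) 2^-1 ^+ al j *
  \sum_(k : {ffun 'I_d -> 'I_n}) \prod_(j < d) (n%:R^-1 * (w ^+ al j / w ^+ be j) ^+ k j)).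
  rewrite mulr_sumr; apply: eq_bigr => k _.
  rewrite mulrCA -!mulrA; congr (_ * _); rewrite -!big_split /=.
  apply: eq_bigr => j _; rewrite hp mxE exprMn exprMn -!exprM (mulnC (al j)).
  ring.
congr (_ * _).
rewrite -(bigA_distr_bigA (fun j (k : 'I_n) =>
  n%:R^-1 * (w ^+ al j / w ^+ be j) ^+ k)) /=.
have nR : n%:R != 0 :> R[i] by rewrite pnatr_eq0 -lt0n.
have E j : \sum_(k < n) n%:R^-1 * (w ^+ al j / w ^+ be j) ^+ k =
    (al j == be j %[mod n])%:R.
  rewrite -mulr_sumr sum_unity_root.
    have -> : (w ^+ al j / w ^+ be j == 1) = (al j == be j %[mod n]).
      rewrite -(eq_prim_root_expr hw) -(inj_eq (mulIf (expf_neq0 (be j) w0))).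
      by rewrite divfK ?expf_neq0 // mul1r.
    by case: ifP => _; rewrite ?mulr0 ?mulVf.
  by rewrite exprMn exprVn -!exprM !(mulnC _ n) !exprM wn !expr1n invr1 mulr1.
under eq_bigr do rewrite E.
case: forallP => [h|/forallP]; first by rewrite big1 // => j _; rewrite h.
by rewrite negb_forall => /existsP[j /negbTE hj]; rewrite (bigD1 j) //= hj mul0r.
Qed.

(** For [n] large the filter isolates the coefficient at [be] from a finite set
    carrying almost all of the sum, and what it leaves outside is a subsum of a
    tail; no absolute convergence is involved. *)
Lemma power_series_eq0 a : is_power_series (fun=> 0) a -> a =1 fun=> 0.
Proof.
move=> ha be.
pose x al := a al * \prod_(j < d) (2^-1 : R[i]) ^+ al j.
suff : x be = 0.
  move=> /eqP; rewrite mulf_eq0 prodf_seq_eq0 => /orP[/eqP //|/hasP[j _]].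
  by rewrite expf_eq0 invr_eq0 pnatr_eq0 andbF.
apply/eqP; rewrite -cabs_eq0 eq_le cabs_ge0 andbT.
apply/ler_addgt0Pr => e e0; rewrite add0r.
(* [n = 1] makes the congruences void: this is the convergence of [x]. *)
have hx : has_sum x 0.
  apply: has_sum_ext (unity_root_filter be (ltn0Sn 0) ha) => al.
  by rewrite (_ : [forall j, _]) ?mulr1 //; apply/forallP => j; rewrite !modn1.
have [A hA] := has_sum_cauchy hx (divr_gt0 e0 (ltr0Sn _ 1)).
pose A' := (be |` A)%fset.
(* modulo a large [n], the only exponent of [A'] congruent to [be] is [be]. *)
pose n := (\max_(al : A') \max_j val al j).+1.
have ltn al j : al \in A' -> (al j < n)%N.
  move=> alA; rewrite ltnS; apply: leq_trans (leq_bigmax [` alA]%fset).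
  exact: (leq_bigmax (F := fun j => al j)).
have beA : be \in A' by rewrite in_fset1U eqxx.
pose P al := [forall j, al j == be j %[mod n]].
have PA al : al \in A' -> P al = (al == be).
  move=> alA; apply/forallP/eqP => [h|-> //]; apply/ffunP => j.
  by have /eqP := h j; rewrite !modn_small ?ltn.
have [B hB] := unity_root_filter be (ltn0Sn _ : 0 < n)%N ha
  (divr_gt0 e0 (ltr0Sn _ 1)).
have := hB (B `|` A')%fset (fsubsetUl _ _).
rewrite subr0; rewrite (@fsum_split _ _ A'); last exact: fsubsetUr.
rewrite (big_fsetD1 be) //= -/n.
have -> : [forall j, be j == be j %[mod n]] by apply/forallP.
rewrite mulr1 big1_fset => [|al]; last first.
  rewrite in_fsetD1 => /andP[ab alA] _.
  by rewrite -/(P al) PA // (negbTE ab) mulr0.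
rewrite addr0 -/(x be); set D := (_ `\` A')%fset => hD.
have hAD : cabs (\sum_(al <- D) x al * (P al)%:R) < e / 2.
  have -> : \sum_(al <- D) x al * (P al)%:R =
      \sum_(al <- [fset al in D | P al]%fset) x al.
    rewrite -big_fset_condE [RHS]big_mkcond /=.
    by apply: eq_bigr => al _; case: (P al); rewrite ?mulr1 ?mulr0.
  apply: hA; apply/fdisjointP => al alA; rewrite !inE .
  by rewrite /= ?inE alA !orbT.
have -> : x be = (x be + \sum_(al <- D) x al * (P al)%:R) -
    \sum_(al <- D) x al * (P al)%:R by rewrite addrK.
by rewrite (le_trans (cabsB _ _)) // (splitr e) ltW // ltrD.
Qed.

Lemma power_series_unique (f : polydisc R d -> R[i]) a b :
  is_power_series f a -> is_power_series f b -> a = b.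
Proof.
move=> ha hb; apply/funext => al; apply/eqP; rewrite -subr_eq0; apply/eqP.
have := is_power_seriesB ha hb; rewrite subrr => h.
exact: (power_series_eq0 h).
Qed.

Lemma coeffsE (f : polydisc R d -> R[i]) a :
  is_power_series f a -> coeffs f = a.
Proof.
move=> ha; rewrite /coeffs; case: xgetP => [b _ hb|/(_ a)//].
exact: power_series_unique hb ha.
Qed.

End Uniqueness.

(** * The Hardy space of the polydisc *)

Section HardySpace.
Variables (R : realType) (d : nat).
Implicit Types (a b : {ffun 'I_d -> nat} -> R[i]) (f g : polydisc R d -> R[i]).
Implicit Types (B : {fset {ffun 'I_d -> nat}}).

Lemma sqsum_le a (C : R) :
  (forall B, \sum_(al <- B) cabs (a al) ^+ 2 <= C) -> (sqsum a <= C%:E)%E.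
Proof.
move=> hC; apply: ge_ereal_sup => _ [A [finA _] <-].
by rewrite fsbig_finite //= sumEFin lee_fin.
Qed.

Lemma sqsum_ge a B : ((\sum_(al <- B) cabs (a al) ^+ 2)%:E <= sqsum a)%E.
Proof.
apply: ereal_sup_ubound; exists [set` B]; first by split.
by rewrite fsbig_finite //= set_fsetK sumEFin.
Qed.

Lemma hardy_coeffs f : hardy f -> is_power_series f (coeffs f).
Proof. by case=> a ha _; rewrite (coeffsE ha). Qed.

Lemma hardy_norm_ge0 f : 0 <= hardy_norm f.
Proof. exact: sqrtr_ge0. Qed.

Lemma fsum_le_hardy_norm f B : hardy f ->
  \sum_(al <- B) cabs (coeffs f al) ^+ 2 <= hardy_norm f ^+ 2.
Proof.
case=> a ha; rewrite /hardy_norm (coeffsE ha) => afin.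
have := sqsum_ge a B; have := sqsum_ge a fset0; rewrite big_nil.
case: (sqsum a) afin => [s| |] //= _; rewrite !lee_fin => s0 hs.
by rewrite sqr_sqrtr.
Qed.

Lemma hardy_norm_le f a (C : R) : is_power_series f a -> 0 <= C ->
  (forall B, \sum_(al <- B) cabs (a al) ^+ 2 <= C ^+ 2) ->
  hardy f /\ hardy_norm f <= C.
Proof.
move=> ha C0 hC; have H := sqsum_le hC; split.
  by exists a => //; apply: le_lt_trans H (ltry _).
rewrite /hardy_norm (coeffsE ha).
have := sqsum_ge a fset0; rewrite big_nil.
case: (sqsum a) H => [s| |] //=; rewrite !lee_fin => sC s0.
by rewrite -(ger0_norm C0) -sqrtr_sqr ler_sqrt ?sqr_ge0.
Qed.

(** A quasi-triangle inequality suffices here: the norm of a difference only has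
    to be finite. *)
Lemma hardyB f g : hardy f -> hardy g -> hardy (f - g) /\
  hardy_norm (f - g) <= 2 * (hardy_norm f + hardy_norm g).
Proof.
move=> hf hg; apply: (hardy_norm_le
  (is_power_seriesB (hardy_coeffs hf) (hardy_coeffs hg))).
  by rewrite mulr_ge0 // addr_ge0 ?hardy_norm_ge0.
move=> B; apply: (@le_trans _ _
  (2 * hardy_norm f ^+ 2 + 2 * hardy_norm g ^+ 2)); last first.
  by have := hardy_norm_ge0 f; have := hardy_norm_ge0 g; nra.
rewrite (le_trans (ler_sum _ (fun al _ => cabsB2_le _ _))) //.
by rewrite big_split /= -!mulr_sumr lerD // ler_pM2l ?fsum_le_hardy_norm.
Qed.

Definition box (n : nat) : {fset {ffun 'I_d -> nat}} :=
  [fset [ffun j => nat_of_ord (k j)] | k : {ffun 'I_d -> 'I_n} in predT]%fset.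

Lemma mem_box n (al : {ffun 'I_d -> nat}) :
  (al \in box n) = [forall j, al j < n]%N.
Proof.
apply/imfsetP/forallP => [[k _ ->] j|h]; first by rewrite ffunE.
exists [ffun j => Ordinal (h j)] => //.
by apply/ffunP => j; rewrite !ffunE.
Qed.

Lemma box_sub m n : (m <= n)%N -> (box m `<=` box n)%fset.
Proof.
move=> mn; apply/fsubsetP => al; rewrite !mem_box => /forallP h.
by apply/forallP => j; apply: leq_trans mn.
Qed.

Lemma sub_box B : exists n, (B `<=` box n)%fset.
Proof.
exists (\max_(al : B) \max_j val al j).+1; apply/fsubsetP => al alB.
rewrite mem_box; apply/forallP => j; rewrite ltnS.
apply: leq_trans (leq_bigmax [` alB]%fset).
exact: (leq_bigmax (F := fun j => al j)).
Qed.

Lemma sum_box_prod (S : comNzSemiRingType) (x : 'I_d -> nat -> S) n :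
  \sum_(al <- box n) \prod_(j < d) x j (al j) =
  \prod_(j < d) \sum_(0 <= k < n) x j k.
Proof.
rewrite big_imfset /=; last first.
  move=> k l _ _ /ffunP kl; apply/ffunP => j; apply: val_inj.
  by have := kl j; rewrite !ffunE.
rewrite big_enum /=.
under [RHS]eq_bigr do rewrite big_mkord.
rewrite bigA_distr_bigA; apply: eq_bigr => k _.
by apply: eq_bigr => j _; rewrite ffunE.
Qed.

Lemma sum_geometric_le (t : R) n : 0 <= t -> t < 1 ->
  \sum_(0 <= k < n) t ^+ k <= (1 - t)^-1.
Proof.
move=> t0 t1; have t10 : 0 < 1 - t by rewrite subr_gt0.
rewrite -[leRHS]mul1r ler_pdivlMr // big_mkord mulrC -opprB mulNr -subrX1 opprB.
by rewrite lerBlDr lerDl exprn_ge0.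
Qed.

(** The squares of the moduli of the monomials have sum [(1 - r ^+ 2) ^- d] at most
    on the polydisc of radius [r].  The products of coefficients and monomials
    are estimated by [u v <= e^-1 u ^ 2 + e v ^ 2]; compared with the
    Cauchy-Schwarz inequality, this only changes the constant. *)
Lemma hardy_eval_le f (z : polydisc R d) (r e : R) : hardy f -> 0 <= r < 1 ->
  (forall j, cabs (val z ord0 j) <= r) -> 0 < e -> hardy_norm f <= e ->
  cabs (f z) <= e * (1 + (1 - r ^+ 2) ^- d).
Proof.
move=> hf /andP[r0 r1] zr e0 fe; set K := (1 - r ^+ 2) ^- d.
have r21 : r ^+ 2 < 1 by rewrite expr_lt1.
apply: cabs_le_has_sum (hardy_coeffs hf z) _ => B.
apply: le_trans (cabs_sum _ _ _) _.
have mon : \sum_(al <- B) cabs (monomial al z) ^+ 2 <= K.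
  have [n Bn] := sub_box B.
  apply: le_trans (ler_fsum _ Bn) _ => [al|]; first exact: sqr_ge0.
  under eq_bigr do rewrite cabs_prod -prodrXl.
  rewrite (sum_box_prod (fun j k => cabs (val z ord0 j ^+ k) ^+ 2)).
  rewrite /K -exprVn -[X in _ ^+ X]card_ord -prodr_const.
  apply: ler_prod => j _; rewrite sumr_ge0 /= => [|k _]; last exact: sqr_ge0.
  apply: le_trans (sum_geometric_le n (sqr_ge0 r) r21).
  apply: ler_sum => k _; rewrite cabsX -exprM mulnC exprM.
  by rewrite lerXn2r ?nnegrE ?sqr_ge0 ?exprn_ge0 // lerXn2r ?nnegrE ?cabs_ge0.
have coe := fsum_le_hardy_norm B hf.
apply: (@le_trans _ _ (\sum_(al <- B) (e^-1 * cabs (coeffs f al) ^+ 2 +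
   e * cabs (monomial al z) ^+ 2))).
  apply: ler_sum => al _; rewrite cabsM.
  have := cabs_ge0 (coeffs f al); have := cabs_ge0 (monomial al z).
  set u := cabs (coeffs f al); set v := cabs _ => v0 u0.
  rewrite -(ler_pM2l e0) mulrDr mulVKf ?gt_eqF //.
  by have := sqr_ge0 (u - e * v); nra.
rewrite big_split /= -!mulr_sumr mulrDr mulr1 lerD //; last by rewrite ler_pM2l.
rewrite mulrC ler_pdivrMr // -expr2 (le_trans coe) //.
by rewrite lerXn2r ?nnegrE ?hardy_norm_ge0 // ltW.
Qed.

End HardySpace.

(** * The Hardy space of the disc and Blaschke factors *)

Section OneVariable.
Variable R : realType.
Implicit Types (f g : R[i] -> R[i]) (c : nat -> R[i]) (z a : R[i]) (u v : nat -> R[i]).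

Lemma cabs_cvg0 u (s : R[i]) :
  (fun n => cabs (u n - s)) @ \oo --> (0 : R) -> u @ \oo --> s.
Proof.
move=> /cvgrPdist_lt h; apply/cvgrPdist_lt => e e0.
have eE : e = (complex.Re e)%:C%C by rewrite RRe_real // gtr0_real.
have Re0 : 0 < complex.Re e by rewrite -ltcR -eE.
have := h _ Re0; apply: filterS => n.
rewrite sub0r normrN ger0_norm ?cabs_ge0 // cabsC eE -ltr_cabs => h1.
exact: h1.
Qed.

Lemma cvg_cabs_lt u (s : R[i]) (e : R) : 0 < e -> u @ \oo --> s ->
  \forall n \near \oo, cabs (u n - s) < e.
Proof.
move=> e0 /cvgrPdist_lt h; have := h e%:C%C; rewrite ltcR => /(_ e0).
by apply: filterS => n h1; rewrite cabsC -ltr_cabs; exact: h1.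
Qed.

Lemma eq_cvg_seq u v (s : R[i]) : u =1 v -> v @ \oo --> s -> u @ \oo --> s.
Proof. by move=> /funext ->. Qed.

Lemma cvg_prodr d (u : 'I_d -> nat -> R[i]) (s : 'I_d -> R[i]) :
  (forall j, u j @ \oo --> s j) ->
  (fun n => \prod_(j < d) u j n) @ \oo --> \prod_(j < d) s j.
Proof.
move=> h; elim: (index_enum _) => [|j r IH].
  rewrite big_nil; apply: eq_cvg_seq (cvg_cst _) => n; exact: big_nil.
rewrite big_cons; apply: eq_cvg_seq (cvgM (h j) IH) => n; exact: big_cons.
Qed.

Lemma cvg_bounded_geometric u (B : R) z : cabs z < 1 ->
  (forall n, cabs (u n) <= B) -> (fun n => u n * z ^+ n) @ \oo --> (0 : R[i]).
Proof.
move=> z1 uB; apply: cabs_cvg0.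
have z1' : `|cabs z| < 1 by rewrite ger0_norm ?cabs_ge0.
have lim : (fun n => B * cabs z ^+ n) @ \oo --> (0 : R).
  by rewrite -(mulr0 B); apply: cvgM (cvg_cst _) (cvg_expr z1').
apply: squeeze_cvgr (cvg_cst 0) lim; apply: nearW => n /=.
by rewrite subr0 cabs_ge0 cabsM cabsX ler_wpM2r // exprn_ge0 // cabs_ge0.
Qed.

(** [f] belongs to the Hardy space of the disc and its squared norm is at most
    [C].  Only the values of [f] in the disc matter, hence no subtype. *)
Definition h2_disc f (C : R) : Prop := exists2 c,
  forall n, \sum_(0 <= k < n) cabs (c k) ^+ 2 <= C &
  forall z, cabs z < 1 -> (fun n => \sum_(0 <= k < n) c k * z ^+ k) @ \oo --> f z.

Lemma h2_disc_ext f g C : (forall z, cabs z < 1 -> f z = g z) ->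
  h2_disc f C -> h2_disc g C.
Proof.
move=> fg [c cC cf]; exists c; first exact: cC.
by move=> z z1; rewrite -(fg _ z1); exact: cf.
Qed.

Lemma h2_disc_le f (C D : R) : C <= D -> h2_disc f C -> h2_disc f D.
Proof.
move=> CD [c cC cf]; exists c; last exact: cf.
by move=> n; rewrite (le_trans (cC n)).
Qed.

Lemma h2_disc1 : h2_disc (fun=> 1) 1.
Proof.
exists (fun k => (k == 0%N)%:R) => [[|n]|z _]; first by rewrite big_nil.
  rewrite big_nat_recl //= cabs1 expr1n big1 ?addr0 // => k _.
  by rewrite cabs0 expr0n.
rewrite -cvg_shiftS; apply: eq_cvg_seq (cvg_cst _) => n /=.
by rewrite big_nat_recl //= big1 ?mulr1 ?addr0 // => k _; rewrite mul0r.
Qed.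

Lemma h2_discZ a f C : h2_disc f C -> h2_disc (fun z => a * f z) (cabs a ^+ 2 * C).
Proof.
case=> c cC cf; exists (fun k => a * c k) => [n|z z1].
  under eq_bigr do rewrite cabsM exprMn.
  by rewrite -mulr_sumr ler_wpM2l // sqr_ge0.
apply: eq_cvg_seq (cvgM (cvg_cst a) (cf z z1)) => n /=.
by rewrite mulr_sumr; apply: eq_bigr => k _; rewrite mulrA.
Qed.

Lemma h2_discD f g C D : h2_disc f C -> h2_disc g D ->
  h2_disc (fun z => f z + g z) (2 * C + 2 * D).
Proof.
case=> c cC cf [b bD bg]; exists (fun k => c k + b k) => [n|z z1].
  apply: le_trans (ler_sum _ (fun k _ => cabsD2_le (c k) (b k))) _.
  by rewrite big_split /= -!mulr_sumr lerD // ler_pM2l.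
apply: eq_cvg_seq (cvgD (cf z z1) (bg z z1)) => n /=.
by under eq_bigr do rewrite mulrDl; rewrite big_split.
Qed.

Lemma h2_discX f C : h2_disc f C -> h2_disc (fun z => z * f z) C.
Proof.
case=> c cC cf; exists (fun k => if k is k'.+1 then c k' else 0) => [[|n]|z z1].
- by rewrite big_nil; have := cC 0%N; rewrite big_nil.
- by rewrite big_nat_recl //= cabs0 expr0n add0r.
rewrite -cvg_shiftS; apply: eq_cvg_seq (cvgM (cvg_cst z) (cf z z1)) => n /=.
rewrite big_nat_recl //= mul0r add0r mulr_sumr.
by apply: eq_bigr => k _; rewrite exprS mulrCA.
Qed.

Lemma blaschke_identity a x y :
  cabs (x - a * y) ^+ 2 + (1 - cabs a ^+ 2) * cabs y ^+ 2 =
  cabs (y - a^*%C * x) ^+ 2 + (1 - cabs a ^+ 2) * cabs x ^+ 2.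
Proof. by rewrite !cabs2E; case: a x y => [? ?] [? ?] [? ?] /=; ring. Qed.

(** If [f] has coefficients [c] then [f / (1 - a^* z)] has the coefficients [g]
    below, and those of the product are [b_n = g_(n-1) - a g_n] while
    [c_n = g_n - a^* g_(n-1)].  Then [|c_n|^2 - |b_n|^2] is [1 - |a|^2] times the
    increment of [|g_n|^2], so that the differences of the partial sums
    telescope. *)
Lemma h2_disc_blaschke a f C : cabs a < 1 -> h2_disc f C ->
  h2_disc (fun z => (z - a) / (1 - a^*%C * z) * f z) C.
Proof.
move=> a1 [c cC cf].
pose g := fix g n := if n is n'.+1 then c n + a^*%C * g n' else c 0%N.
pose b n := (if n is n'.+1 then g n' else 0) - a * g n.
have a21 : 0 < 1 - cabs a ^+ 2 by rewrite subr_gt0 expr_lt1 ?cabs_ge0.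
have sumE n : \sum_(0 <= k < n.+1) cabs (b k) ^+ 2 +
    (1 - cabs a ^+ 2) * cabs (g n) ^+ 2 = \sum_(0 <= k < n.+1) cabs (c k) ^+ 2.
  elim: n => [|n IH].
    rewrite !big_nat1 blaschke_identity cabs0 mulr0 expr0n mulr0 addr0 subr0.
    by [].
  rewrite big_nat_recr //= [RHS]big_nat_recr //= -IH -!addrA; congr (_ + _).
  rewrite -/(g n.+1) blaschke_identity /= addrK addrC.
  by [].
have gB n : cabs (g n) <= Num.sqrt (C / (1 - cabs a ^+ 2)).
  rewrite -(ger0_norm (cabs_ge0 _)) -sqrtr_sqr ler_sqrt; last first.
    by rewrite divr_ge0 ?(le_trans _ (cC 0%N)) ?big_nil // ltW.
  rewrite ler_pdivlMr // mulrC (le_trans _ (cC n.+1)) // -sumE lerDr.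
  by rewrite sumr_ge0 // => k _; rewrite sqr_ge0.
exists b => [[|n]|z z1]; first by rewrite big_nil; have := cC 0%N; rewrite big_nil.
  by rewrite (le_trans _ (cC n.+1)) // -sumE lerDl mulr_ge0 ?sqr_ge0 // ltW.
have nz : 1 - a^*%C * z != 0.
  rewrite subr_eq0; apply: contraTneq (mulr_ilt1 (cabs_ge0 a) (cabs_ge0 z) a1 z1).
  by move=> e; rewrite -(cabs_conj a) -cabsM -e cabs1 ltxx.
have prodE n : (1 - a^*%C * z) * \sum_(0 <= k < n.+1) b k * z ^+ k =
    (z - a) * (\sum_(0 <= k < n.+1) c k * z ^+ k) -
    (1 - a * a^*%C) * z * (g n * z ^+ n).
  elim: n => [|n IH]; first by rewrite !big_nat1 /b /= expr0; ring.
  rewrite big_nat_recr //= mulrDr IH [in RHS]big_nat_recr //=.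
  by rewrite /b /= exprS; ring.
have lim0 : (1 - a * a^*%C) * z * (g n * z ^+ n) @[n --> \oo] --> (0 : R[i]).
  rewrite -(mulr0 ((1 - a * a^*%C) * z)).
  exact: cvgM (cvg_cst _) (cvg_bounded_geometric z1 gB).
have -> : (z - a) / (1 - a^*%C * z) * f z =
    (1 - a^*%C * z)^-1 * ((z - a) * f z - 0) by rewrite subr0 mulrCA mulrA.
have lim := cf z z1; rewrite -cvg_shiftS in lim.
rewrite -cvg_shiftS.
apply: eq_cvg_seq (cvgM (cvg_cst _) (cvgB (cvgM (cvg_cst _) lim) lim0)) => n /=.
by apply: (mulfI nz); rewrite prodE mulVKf.
Qed.

End OneVariable.

(** * Products of functions of one variable; approximation numbers *)

Section ElementaryTensors.
Variables (R : realType) (d : nat).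

(** The bound on the sums of moduli makes the part outside of a large box
    uniformly small, so that the limit along boxes is the unordered sum. *)
Lemma has_sum_box (x : {ffun 'I_d -> nat} -> R[i]) (s : R[i]) (K : R) :
  (fun n => \sum_(al <- box d n) x al) @ \oo --> s ->
  (forall n, \sum_(al <- box d n) cabs (x al) <= K) -> has_sum x s.
Proof.
move=> lim xK e e0; have e20 := divr_gt0 e0 (ltr0Sn R 1).
pose P n := \sum_(al <- box d n) cabs (x al).
have Psup : has_sup (range P).
  by split; [exists (P 0%N), 0%N|exists K => _ [n _ <-]; exact: xK].
have [_ [N _ <-] PN] := sup_adherent e20 Psup.
have [M _ hM] := cvg_cabs_lt e20 lim.
exists (box d (maxn N M)) => B sB.
have [n Bn] := sub_box B.
have boxn : (box d (maxn N M) `<=` box d (maxn n (maxn N M)))%fset.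
  by apply: box_sub; rewrite leq_maxr.
rewrite (fsum_split _ sB) addrAC (splitr e) (le_lt_trans (cabsD _ _)) //.
rewrite ltrD //; first by apply: hM; rewrite /= leq_maxr.
apply: le_lt_trans (cabs_sum _ _ _) _.
have sD : (B `\` box d (maxn N M) `<=`
    box d (maxn n (maxn N M)) `\` box d (maxn N M))%fset.
  apply: fsetSD; apply: fsubset_trans Bn _.
  by apply: box_sub; rewrite leq_maxl.
apply: le_lt_trans (ler_fsum _ sD) _ => [al|]; first exact: cabs_ge0.
have := fsum_split (fun al => cabs (x al)) boxn.
rewrite -/(P _) -/(P _) => PE.
have PNM : P N <= P (maxn N M).
  apply: ler_fsum => [al|]; first exact: cabs_ge0.
  by apply: box_sub; rewrite leq_maxl.
have Pn : P (maxn n (maxn N M)) <= sup (range P).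
  by apply: sup_upper_bound => //; exists (maxn n (maxn N M)).
move: PE PN PNM Pn; lra.
Qed.

(** The coefficients of the product are the products of the coefficients, and sums
    over boxes factorize.  The test functions are of this form. *)
Lemma hardy_tensor (F : 'I_d -> R[i] -> R[i]) (C : 'I_d -> R) (D : R) :
  (forall j, h2_disc (F j) (C j)) -> 0 <= D -> \prod_(j < d) C j <= D ^+ 2 ->
  hardy (fun z : polydisc R d => \prod_(j < d) F j (val z ord0 j)) /\
  hardy_norm (fun z : polydisc R d => \prod_(j < d) F j (val z ord0 j)) <= D.
Proof.
move=> hF D0 CD.
have /boolp.choice[c hc] j : exists c : nat -> R[i],
    (forall n, \sum_(0 <= k < n) cabs (c k) ^+ 2 <= C j) /\
    (forall z, cabs z < 1 ->
      (fun n => \sum_(0 <= k < n) c k * z ^+ k) @ \oo --> F j z).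
  by have [c cC cF] := hF j; exists c; split; [exact: cC|exact: cF].
apply: (@hardy_norm_le _ _ _ (fun al => \prod_(j < d) c j (al j))) => //.
- move=> z.
  pose x (al : {ffun 'I_d -> nat}) : R[i] :=
    \prod_(j < d) (c j (al j) * val z ord0 j ^+ al j).
  apply: (@has_sum_ext _ _ x) => [al|]; first by rewrite /x big_split.
  have zj j : cabs (val z ord0 j) < 1 by have /forallP := valP z; apply.
  apply: (@has_sum_box _ _
      (\prod_(j < d) (C j + (1 - cabs (val z ord0 j) ^+ 2)^-1))).
    apply: eq_cvg_seq (cvg_prodr (fun j => proj2 (hc j) _ (zj j))) => n.
    exact: (sum_box_prod (fun j k => c j k * val z ord0 j ^+ k)).
  move=> n; under eq_bigr do rewrite cabs_prod.
  rewrite (sum_box_prod (fun j k => cabs (c j k * val z ord0 j ^+ k))).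
  apply: ler_prod => j _; rewrite sumr_ge0 /= => [|k _]; last exact: cabs_ge0.
  have r21 : cabs (val z ord0 j) ^+ 2 < 1 by rewrite expr_lt1 ?cabs_ge0.
  apply: (@le_trans _ _ (\sum_(0 <= k < n) (cabs (c j k) ^+ 2 +
    (cabs (val z ord0 j) ^+ 2) ^+ k))).
    apply: ler_sum => k _; rewrite cabsM cabsX -exprM mulnC exprM.
    have := cabs_ge0 (c j k); have := exprn_ge0 k (cabs_ge0 (val z ord0 j)).
    set u := cabs (c j k); set v := _ ^+ k => v0 u0.
    have := sqr_ge0 (u - v); nra.
  rewrite big_split lerD //; first by have [] := hc j.
  exact: sum_geometric_le (sqr_ge0 _) r21.
- move=> B; have [n Bn] := sub_box B.
  apply: le_trans (ler_fsum _ Bn) _ => [al|]; first exact: sqr_ge0.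
  under eq_bigr do rewrite cabs_prod -prodrXl.
  rewrite (sum_box_prod (fun j k => cabs (c j k) ^+ 2)).
  apply: le_trans CD; apply: ler_prod => j _.
  by rewrite sumr_ge0 /= => [|k _]; [have [] := hc j|exact: sqr_ge0].
Qed.

End ElementaryTensors.

Section ApproximationNumbers.
Variables (R : realType) (d : nat).
Implicit Types (T S : (polydisc R d -> R[i]) -> (polydisc R d -> R[i])).

Local Notation hardy := (@hardy R d).
Local Notation norm := (@hardy_norm R d).

(** The supremum defining the norm is that of a bounded set because both operators
    are bounded; otherwise it would be a default value. *)
Lemma opnorm_ge T S f : bounded_operator hardy norm T ->
  bounded_operator hardy norm S -> hardy f -> norm f <= 1 ->
  norm (T f - S f) <= opnorm hardy norm (fun f => T f - S f).
Proof.
move=> [TH _ [M TM]] [SH _ [M' SM]] hf f1; apply: sup_upper_bound; last first.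
  by exists f.
split; first by exists (norm (T f - S f)), f.
exists (2 * (`|M| + `|M'|)) => _ [g [hg g1] <-].
have [_] := hardyB (TH _ hg) (SH _ hg); move/le_trans; apply.
rewrite ler_pM2l // lerD //.
  rewrite (le_trans (TM _ hg)) // -[leRHS]mulr1.
  by rewrite (le_trans (ler_wpM2r (hardy_norm_ge0 g) (ler_norm M))) // ler_wpM2l.
rewrite (le_trans (SM _ hg)) // -[leRHS]mulr1.
by rewrite (le_trans (ler_wpM2r (hardy_norm_ge0 g) (ler_norm M'))) // ler_wpM2l.
Qed.

Lemma hardy_zero : hardy 0 /\ norm 0 <= 0.
Proof.
apply: (@hardy_norm_le _ _ _ (fun=> 0)) => // [z|B].
  by apply: has_sum_ext (@has_sum0 _ _) => al; rewrite mul0r.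
by rewrite big1 ?expr0n // => al _; rewrite cabs0 expr0n.
Qed.

Lemma bounded_operator0 : bounded_operator hardy norm (fun=> 0).
Proof.
have [h0 n0] := hardy_zero; split=> [f _|c f g _ _|].
- exact: h0.
- by rewrite scaler0 addr0.
- by exists 0 => f _; rewrite mul0r.
Qed.

Lemma rank_lt0 n : (0 < n)%N -> rank_lt hardy (fun=> 0) n.
Proof.
move=> n0; exists 0%N => //; exists (fun=> 0) => f _.
by exists (fun=> 0); rewrite big_ord0.
Qed.

Lemma opnorm_ge0 T : 0 <= opnorm hardy norm T.
Proof.
rewrite /opnorm; have [h0 n0] := hardy_zero.
set A := [set _ | _ in _]; have A0 : A (norm (T 0)).
  by exists 0 => //; split => //; apply: le_trans n0 ler01.
have [As|/sup_out -> //] := pselect (has_sup A).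
exact: le_trans (hardy_norm_ge0 _) (sup_upper_bound As A0).
Qed.

Lemma approx_num_le T n (M : R) : (0 < n)%N -> 0 <= M ->
  (forall f, hardy f -> norm (T f) <= M * norm f) ->
  approx_num hardy norm T n <= M.
Proof.
move=> n0 M0 TM; apply: (@le_trans _ _ (opnorm hardy norm (fun f => T f - 0))).
  apply: ge_inf; first by exists 0 => _ [S _ <-]; exact: opnorm_ge0.
  exists (fun=> 0) => //.
  by split; [exact: bounded_operator0|exact: rank_lt0].
have [h0 f0] := hardy_zero; apply: ge_sup.
  by exists (norm (T 0 - 0)), 0 => //; split => //; apply: le_trans f0 ler01.
move=> _ [f [hf f1] <-]; rewrite subr0 (le_trans (TM _ hf)) //.
by rewrite -[leRHS]mulr1 ler_wpM2l.
Qed.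

Lemma approx_num_ge T n (e : R) : (0 < n)%N ->
  (forall S, bounded_operator hardy norm S -> rank_lt hardy S n ->
    e <= opnorm hardy norm (fun f => T f - S f)) ->
  e <= approx_num hardy norm T n.
Proof.
move=> n0 h; apply: lb_le_inf; last by move=> _ [S [bS rS] <-]; exact: h.
exists (opnorm hardy norm (fun f => T f - 0)), (fun=> 0) => //.
by split; [exact: bounded_operator0|exact: rank_lt0].
Qed.

End ApproximationNumbers.

(** * The lower bound from biorthogonal test functions *)

Section LowerBound.
Variables (R : realType) (d : nat).

Local Notation hardy := (@hardy R d).
Local Notation norm := (@hardy_norm R d).

Lemma left_kernel_neq0 (K : fieldType) (I : finType) k (c : I -> 'I_k -> K) :
  (k < #|I|)%N ->
  exists2 x : I -> K, exists i, x i != 0 & forall j, \sum_i x i * c i j = 0.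
Proof.
move=> kI; pose A : 'M[K]_(#|I|, k) := \matrix_(i, j) c (enum_val i) j.
have : kermx A != 0.
  rewrite kermx_eq0 /row_free; apply/eqP => rkA.
  by have := rank_leq_col A; rewrite rkA leqNgt kI.
case/rowV0Pn => v /sub_kermxP vA v0.
exists (fun i => v ord0 (enum_rank i)).
  move: v0 => /rV0Pn[i vi]; exists (enum_val i).
  by rewrite enum_valK.
move=> j; have := congr1 (fun B : 'rV[K]_k => B ord0 j) vA.
rewrite !mxE => {2}<-; rewrite (reindex enum_rank); last first.
  by apply: onW_bij; exact: enum_rank_bij.
by apply: eq_bigr => i _; rewrite mxE enum_rankK.
Qed.

Lemma hardy_normalize f (C : R) : 0 < C -> hardy f -> norm f <= C ->
  hardy (C^-1%:C%C *: f) /\ norm (C^-1%:C%C *: f) <= 1.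
Proof.
move=> C0 hf fC.
apply: (@hardy_norm_le _ _ _ (fun al => C^-1%:C%C * coeffs f al)) => // [z|B].
  apply: has_sum_ext (has_sumZ C^-1%:C%C (hardy_coeffs hf z)) => al.
  by rewrite mulrA.
under eq_bigr do rewrite cabsM exprMn cabs_real.
rewrite -mulr_sumr ger0_norm ?invr_ge0 ?(ltW C0) // expr1n exprVn.
rewrite mulrC ler_pdivrMr ?exprn_gt0 // mul1r.
rewrite (le_trans (fsum_le_hardy_norm B hf)) //.
by rewrite lerXn2r ?nnegrE ?hardy_norm_ge0 // ltW.
Qed.

(** Lower bound from almost biorthogonal test functions.  If an operator [S] of
    rank less than [#|I|] were too close to composition with [Phi], the matrix
    of the values of the [S (F i)] at the points [z l] would be diagonally
    dominant; but it factors through a space of dimension less than [#|I|]. *)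
Lemma approx_num_comp_ge (Phi : polydisc R d -> polydisc R d) (I : finType)
    (z : I -> polydisc R d) (F : I -> polydisc R d -> R[i]) (n : nat) (r C : R) :
  bounded_operator hardy norm (comp_op Phi) ->
  (0 < n)%N -> (n <= #|I|)%N -> 0 <= r < 1 -> 0 < C ->
  (forall l j, cabs (val (z l) ord0 j) <= r) ->
  (forall i, hardy (F i)) -> (forall i, norm (F i) <= C) ->
  (forall i l, cabs (F i (Phi (z l)) - (i == l)%:R) <= (4 * #|I|%:R)^-1) ->
  (2 * #|I|%:R * C * (1 + (1 - r ^+ 2) ^- d))^-1 <=
    approx_num hardy norm (comp_op Phi) n.
Proof.
move=> bPhi n0 nI r01 C0 zr FH FC Fdelta.
set K := 1 + _; set N : R := #|I|%:R.
have N0 : 0 < N by rewrite ltr0n (leq_trans n0).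
have K0 : 0 < K.
  rewrite ltr_pwDl // invr_ge0 exprn_ge0 // subr_ge0.
  by case/andP: r01 => r0 r1; rewrite expr_le1 // ltW.
set e := (X in X <= _); have e0 : 0 < e by rewrite invr_gt0 !mulr_gt0.
apply: approx_num_ge => // S bS [k kn [b hb]].
rewrite leNgt; apply/negP => small.
pose f i := C^-1%:C%C *: F i.
have fH i : hardy (f i) by have [] := hardy_normalize C0 (FH i) (FC i).
have f1 i : norm (f i) <= 1 by have [] := hardy_normalize C0 (FH i) (FC i).
have close i l : cabs (f i (Phi (z l)) - S (f i) (z l)) <= (2 * N * C)^-1.
  have -> : (2 * N * C)^-1 = e * K.
    by rewrite /e [in RHS]invfM mulfVK ?gt_eqF.
  have [TH _ _] := bPhi; have [SH _ _] := bS.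
  have [gH _] := hardyB (TH _ (fH i)) (SH _ (fH i)).
  apply: (hardy_eval_le gH r01 (zr l) e0).
  by rewrite ltW // (le_lt_trans (opnorm_ge bPhi bS (fH i) (f1 i))).
have /boolp.choice[c hc] i : exists c : 'I_k -> R[i],
    S (f i) = \sum_(j < k) c j *: b j by exact: hb.
have [x [i0 xi0] xc] := left_kernel_neq0 c (leq_trans kn nI).
pose l := [arg max_(i > i0) cabs (x i)]%O.
have xl i : cabs (x i) <= cabs (x l).
  by rewrite /l; case: Order.TotalTheory.arg_maxP => // i1 _; apply.
have xl0 : 0 < cabs (x l) by rewrite (lt_le_trans _ (xl i0)) // cabs_gt0.
have Sx : \sum_i x i * S (f i) (z l) = 0.
  under eq_bigr do rewrite hc fct_sumE mulr_sumr.
  rewrite exchange_big big1 //= => j _.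
  under eq_bigr => i _ do rewrite /= mulrA.
  by rewrite -mulr_suml xc mul0r.
(* row [l] of the singular matrix, tested against its kernel vector at the
   largest entry *)
have xE : C^-1%:C%C * x l = \sum_i x i * (C^-1%:C%C * (i == l)%:R - S (f i) (z l)).
  under eq_bigr do rewrite mulrBr.
  rewrite sumrB Sx subr0 (bigD1 l) //= eqxx mulr1 big1 ?addr0 1?mulrC //.
  by move=> i /negbTE ->; rewrite !mulr0.
have term i : cabs (C^-1%:C%C * (i == l)%:R - S (f i) (z l)) <=
    (4 * N * C)^-1 + (2 * N * C)^-1.
  have -> : C^-1%:C%C * (i == l)%:R - S (f i) (z l) =
      C^-1%:C%C * ((i == l)%:R - F i (Phi (z l))) +
      (f i (Phi (z l)) - S (f i) (z l)).
    by rewrite mulrBr addrA subrK.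
  rewrite (le_trans (cabsD _ _)) // lerD // cabsM cabs_real cabsC.
  rewrite ger0_norm ?invr_ge0 ?(ltW C0) // mulrC invfM.
  by rewrite ler_wpM2r // invr_ge0 ltW.
have : cabs (C^-1%:C%C * x l) <= 3 / 4 * (C^-1 * cabs (x l)).
  rewrite xE (le_trans (cabs_sum _ _ _)) //.
  apply: (@le_trans _ _
      (\sum_(i : I) cabs (x l) * ((4 * N * C)^-1 + (2 * N * C)^-1))).
    apply: ler_sum => i _; rewrite cabsM.
    by rewrite ler_pM ?cabs_ge0.
  rewrite sumr_const -[_ *+ _]mulr_natr -/N le_eqVlt; apply/orP; left.
  by apply/eqP; field; rewrite !gt_eqF.
rewrite cabsM cabs_real ger0_norm ?invr_ge0 ?(ltW C0) //.
have : 0 < C^-1 * cabs (x l) by rewrite mulr_gt0 // invr_gt0.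
lra.
Qed.

End LowerBound.

(** * Blaschke products on a geometric sequence of radii *)

Section Blaschke.
Variable R : realType.
Implicit Types (a v w z : R[i]) (q : R).

Definition blaschke a z : R[i] := (z - a) / (1 - a^*%C * z).

(** The pseudohyperbolic distance of two points of given moduli [s] and [t] is
    least when they lie on a common radius, where it is [|s - t| / (1 - s t)];
    and [1 - s t] is at most [(1 - s) + (1 - t)]. *)
Lemma cabs_blaschke_ge a w : cabs a < 1 -> cabs w < 1 ->
  `|cabs a - cabs w| / (2 - cabs a - cabs w) <= cabs (blaschke a w).
Proof.
move=> a1 w1; have := cabs_ge0 a; have := cabs_ge0 w.
rewrite /blaschke cabsM cabsV.
set s := cabs a in a1 *; set t := cabs w in w1 * => t0 s0.
have st1 : 0 < 1 - s * t by nra.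
have nz : 0 < cabs (1 - a^*%C * w).
  rewrite cabs_gt0 subr_eq0; apply: contraTneq st1 => e.
  by rewrite /s -(cabs_conj a) -cabsM -e cabs1 subrr ltxx.
have key : (s - t) ^+ 2 * cabs (1 - a^*%C * w) ^+ 2 <=
    cabs (w - a) ^+ 2 * (1 - s * t) ^+ 2.
  pose rho := complex.Re (a^*%C * w).
  have hs : s ^+ 2 = complex.Re a ^+ 2 + complex.Im a ^+ 2 by rewrite -cabs2E.
  have ht : t ^+ 2 = complex.Re w ^+ 2 + complex.Im w ^+ 2 by rewrite -cabs2E.
  have rho_le : rho <= s * t.
    rewrite /s /t -(cabs_conj a) -cabsM.
    have : rho ^+ 2 <= cabs (a^*%C * w) ^+ 2 by rewrite cabs2E lerDl sqr_ge0.
    have [rho0|rho0 _] := leP 0 rho; first by rewrite ler_pXn2r ?nnegrE ?cabs_ge0.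
    exact: le_trans (ltW rho0) (cabs_ge0 _).
  have -> : cabs (1 - a^*%C * w) ^+ 2 = 1 + s ^+ 2 * t ^+ 2 - 2 * rho.
    rewrite cabs2E hs ht /rho; case: (a) (w) => [? ?] [? ?] /=; ring.
  have -> : cabs (w - a) ^+ 2 = s ^+ 2 + t ^+ 2 - 2 * rho.
    rewrite cabs2E hs ht /rho; case: (a) (w) => [? ?] [? ?] /=; ring.
  rewrite -subr_ge0.
  have -> : (s ^+ 2 + t ^+ 2 - 2 * rho) * (1 - s * t) ^+ 2 -
      (s - t) ^+ 2 * (1 + s ^+ 2 * t ^+ 2 - 2 * rho) =
      2 * (s * t - rho) * ((1 - s ^+ 2) * (1 - t ^+ 2)) by ring.
  by rewrite !mulr_ge0 // subr_ge0 // expr_le1 // ltW.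
apply: (@le_trans _ _ (`|s - t| / (1 - s * t))).
  rewrite ler_wpM2l // lef_pV2 ?posrE //; last by lra.
  nra.
rewrite ler_pdivrMr // mulrAC ler_pdivlMr //.
rewrite -(@ler_pXn2r _ 2) ?nnegrE ?mulr_ge0 ?cabs_ge0 ?(ltW st1) //.
by rewrite !exprMn real_normK ?num_real.
Qed.

Lemma h2_disc_blaschke_prod (I : Type) (r : seq I) (P : pred I) (a : I -> R[i]) :
  (forall i, cabs (a i) < 1) ->
  h2_disc (fun z => \prod_(i <- r | P i) blaschke (a i) z) 1.
Proof.
move=> a1; elim: r => [|i r IH].
  by apply: h2_disc_ext (h2_disc1 R) => z _; rewrite big_nil.
have [Pi|nPi] := boolP (P i).
  apply: h2_disc_ext (h2_disc_blaschke (a1 i) IH) => z _.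
  by rewrite big_cons Pi.
by apply: h2_disc_ext IH => z _; rewrite big_cons (negbTE nPi).
Qed.

(** The pseudohyperbolic distance of [1 - x] and [1 - q ^+ k * x] is at least
    [tau q k]. *)
Definition tau q (k : nat) : R := (1 - q ^+ k) / (1 + q ^+ k).

Lemma tau_ge0_le1 q k : 0 < q < 1 -> 0 <= tau q k <= 1.
Proof.
case/andP=> q0 q1; have h0 := exprn_gt0 k q0.
have h1 : q ^+ k <= 1 by rewrite exprn_ile1 ?ltW.
rewrite /tau; apply/andP; split; first by apply: divr_ge0; lra.
by rewrite ler_pdivrMr ?mul1r; lra.
Qed.

(** By Bernoulli's inequality [1 - q] is at least [3 / (4 s)], and [1 - q ^+ k] is
    at least [k (1 - q) / 4] as long as [q ^+ k] is at least [1 / 4]. *)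
Lemma tau_ge q s k : (0 < s)%N -> 0 < q < 1 -> q ^+ s = 4^-1 -> (k <= s)%N ->
  k%:R / (16 * s%:R) <= tau q k.
Proof.
move=> s0 /andP[q0 q1] qs ks.
have sR : 0 < s%:R :> R by rewrite ltr0n.
have q_ge i : (i <= s)%N -> 4^-1 <= q ^+ i.
  by move=> h; rewrite -qs ler_wiXn2l // ltW.
have lin i : (i <= s)%N -> q ^+ i <= 1 - i%:R * (1 - q) / 4.
  elim: i => [|i IH] h; first by rewrite expr0 mul0r mul0r subr0.
  have := IH (ltnW h); have := q_ge _ (ltnW h).
  rewrite exprSr -natr1; nra.
have bern i : 1 - i%:R * (1 - q) <= q ^+ i.
  elim: i => [|i IH]; first by rewrite expr0 mul0r subr0.
  have h1 : 0 <= i%:R :> R by rewrite ler0n.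
  have h2 : 0 <= i%:R * (1 - q) ^+ 2 by rewrite mulr_ge0 ?sqr_ge0.
  by have := ler_wpM2r (ltW q0) IH; rewrite exprSr -natr1; nra.
have q1s : 3 / 4 <= s%:R * (1 - q) by have := bern s; rewrite qs; lra.
have := lin _ ks; have := q_ge _ ks; set y := q ^+ k => y_ge y_le.
have y1 : y <= 1 by rewrite exprn_ile1 // ltW.
rewrite /tau -/y ler_pdivrMr ?mulr_gt0 // mulrAC ler_pdivlMr; last by lra.
have k0 : 0 <= k%:R :> R by rewrite ler0n.
have h2 : k%:R * (3 / 4) <= 4 * s%:R * (1 - y).
  apply: (@le_trans _ _ (k%:R * (s%:R * (1 - q)))); first by rewrite ler_wpM2l.
  have : k%:R * (1 - q) <= 4 * (1 - y) by move: y_le; lra.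
  by rewrite -(ler_pM2l sR); lra.
move: h2; nra.
Qed.

(** The lower bounds of the factors multiply up to [s`! / (16 s) ^ s]; the series of
    the exponential shows [s ^ s <= e ^ s s`!]. *)
Lemma prod_tau_first q s : (0 < s)%N -> 0 < q < 1 -> q ^+ s = 4^-1 ->
  (16 * expR 1) ^- s <= \prod_(0 <= k < s) tau q k.+1.
Proof.
move=> s0 q01 qs.
have sR : 0 < s%:R :> R by rewrite ltr0n.
apply: (@le_trans _ _ (\prod_(0 <= k < s) (k.+1%:R / (16 * s%:R)))); last first.
  rewrite big_nat [leRHS]big_nat; apply: ler_prod => k /andP[_ ks].
  by rewrite divr_ge0 ?mulr_ge0 ?(ltW sR) //= tau_ge.
rewrite big_split /= prodr_const_nat subn0 -natr_prod exprVn exprMn invfM.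
have -> : (\prod_(0 <= k < s) k.+1)%N = s`!.
  by rewrite fact_prod big_add1.
have fact_ge : s%:R ^+ s <= expR 1 ^+ s * s`!%:R :> R.
  have := @expR_ge1Dxn R s%:R s.-1 (ltW sR).
  rewrite prednK // -expRM_natr mul1r => h.
  rewrite -ler_pdivrMr ?ltr0n ?fact_gt0 //.
  by apply: le_trans h; rewrite lerDr.
rewrite exprMn [in leRHS]invfM mulrCA ler_wpM2l ?invr_ge0 ?exprn_ge0 //.
rewrite ler_pdivlMr ?exprn_gt0 // mulrC ler_pdivrMr ?exprn_gt0 ?expR_gt0 //.
by rewrite mulrC.
Qed.

(** The bound does not depend on the number [p] of blocks of length [s]: in the
    block of index [b] each factor is at least [(1 - 4 ^- b) ^+ 2]. *)
Lemma prod_tau_ge q s p : (0 < s)%N -> 0 < q < 1 -> q ^+ s = 4^-1 -> (0 < p)%N ->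
  (64 * expR 1) ^- s <= \prod_(0 <= k < p * s) tau q k.+1.
Proof.
move=> s0 q01 qs p0; have e0 : 0 < expR 1 :> R := expR_gt0 _.
(* [2/3 (1 + 2 * 4 ^- p)] is below the product of the [1 - 4 ^- b] with
   [0 < b < p]. *)
suff : (16 * expR 1) ^- s * (2 / 3 * (1 + 2 * 4 ^- p)) ^+ (2 * s) <=
    \prod_(0 <= k < p * s) tau q k.+1.
  have v0 : 0 <= 4 ^- p :> R by rewrite invr_ge0 exprn_ge0.
  have u0 : 0 <= (16 * expR 1)^-1 :> R by rewrite invr_ge0 mulr_ge0 // ltW.
  have w4 : 4^-1 <= (2 / 3 * (1 + 2 * 4 ^- p)) ^+ 2 :> R by nra.
  apply: le_trans; rewrite exprM -!exprVn -exprMn.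
  have -> : (64 * expR 1)^-1 = (16 * expR 1)^-1 * 4^-1 :> R.
    by rewrite -invfM; congr (_^-1); ring.
  by rewrite exprVn lerXn2r ?nnegrE ?ler_wpM2l // mulr_ge0 ?sqr_ge0.
elim: p p0 => [//|[_ _|p IH _]].
  rewrite mul1n expr1; have -> : 2 / 3 * (1 + 2 * 4^-1) = 1 :> R by field.
  by rewrite expr1n mulr1 prod_tau_first.
have -> : (p.+2 * s = p.+1 * s + s)%N by rewrite mulSnr.
rewrite (big_cat_nat _ (n := p.+1 * s)%N) ?leq_addr //=.
rewrite -{2}(add0n (p.+1 * s)%N) big_addn addKn.
set t : R := 4 ^- p.+1.
have t0 : 0 < t by rewrite invr_gt0 exprn_gt0.
have t4 : t <= 4^-1.
  by rewrite lef_pV2 ?posrE ?exprn_gt0 // exprS ler_peMr // exprn_ege1 // ler1n.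
apply: (@le_trans _ _ ((16 * expR 1) ^- s * (2 / 3 * (1 + 2 * t)) ^+ (2 * s) *
   ((1 - t) ^+ 2) ^+ s)).
  have -> : 4 ^- p.+2 = 4^-1 * t :> R by rewrite exprS invfM.
  set v := 2 / 3 * (1 + 2 * t); set v' := 2 / 3 * _.
  rewrite -exprM -mulrA -exprMn ler_wpM2l.
  - by [].
  - by rewrite invr_ge0 exprn_ge0 // mulr_ge0 // ltW.
  have v'0 : 0 <= v' by rewrite /v'; lra.
  have vv' : v' <= v * (1 - t) by rewrite /v /v'; nra.
  by rewrite lerXn2r ?nnegrE // (le_trans v'0).
apply: ler_pM.
- by rewrite mulr_ge0 ?invr_ge0 ?exprn_ge0 // ?mulr_ge0 ?(ltW e0) //; lra.
- by rewrite exprn_ge0 // sqr_ge0.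
- exact: IH.
rewrite -[X in _ ^+ X](subn0 s) -prodr_const_nat.
apply: ler_prod => k _; rewrite sqr_ge0 /=.
have y0 : 0 < q ^+ (k + p.+1 * s).+1 by case/andP: q01 => q0 _; rewrite exprn_gt0.
have yt : q ^+ (k + p.+1 * s).+1 <= t.
  case/andP: q01 => q0 q1.
  rewrite /t -exprVn -qs -exprM mulnC ler_wiXn2l ?ltW //.
  by rewrite leqW // leq_addl.
rewrite /tau; set y := q ^+ _ in y0 yt *.
rewrite ler_pdivlMr; last by lra.
nra.
Qed.

Lemma prod_le_prefix (x : nat -> R) m n : (forall k, 0 <= x k <= 1) ->
  (m <= n)%N -> \prod_(0 <= k < n) x k <= \prod_(0 <= k < m) x k.
Proof.
move=> x01 mn; rewrite (big_cat_nat _ mn) //=.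
rewrite ler_piMr ?prodr_ge0 //; last by apply: prodr_ile1 => k _; exact: x01.
by move=> k _; case/andP: (x01 k).
Qed.

(** The indices below [j] and those above [j] each run through an initial segment
    of the distances. *)
Lemma prod_dist_ge (x : nat -> R) n (j : 'I_n) : (forall k, 0 <= x k <= 1) ->
  (\prod_(0 <= k < n) x k.+1) ^+ 2 <=
    \prod_(l < n | l != j) x ((l - j) + (j - l))%N.
Proof.
move=> x01; have jn := ltn_ord j.
have x01' k : 0 <= x k.+1 <= 1 by [].
have pre m : (m <= n)%N -> \prod_(0 <= k < n) x k.+1 <= \prod_(0 <= k < m) x k.+1.
  exact: (prod_le_prefix x01').
have P0 m : 0 <= \prod_(0 <= k < m) x k.+1.
  by apply: prodr_ge0 => k _; case/andP: (x01' k).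
have -> : \prod_(l < n | l != j) x ((l - j) + (j - l))%N =
    \prod_(0 <= l < n | l != j :> nat) x ((l - j) + (j - l))%N.
  by rewrite big_mkord.
rewrite [leRHS](big_cat_nat _ (ltnW jn)) //= [X in _ <= _ * X]big_ltn_cond //= ?eqxx /=.
have -> : \prod_(0 <= l < j | l != j :> nat) x ((l - j) + (j - l))%N =
    \prod_(0 <= k < j) x k.+1.
  rewrite big_nat_rev big_nat_cond [RHS]big_nat_cond.
  apply: eq_big => [k|k /andP[/andP[_ kj] _]]; first by lia.
  by congr x; lia.
have -> : \prod_(j.+1 <= l < n | l != j :> nat) x ((l - j) + (j - l))%N =
    \prod_(0 <= k < n - j.+1) x k.+1.
  rewrite -{1}(add0n j.+1) big_addn big_nat_cond [RHS]big_nat_cond.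
  apply: eq_big => [k|k /andP[/andP[_ kj] _]]; first by lia.
  by congr x; lia.
by rewrite expr2 ler_pM ?P0 // pre // ?leq_subr // ltnW.
Qed.

End Blaschke.

Section DiscNodes.
Variable R : realType.
Implicit Types (phi : disc R -> disc R) (u : disc R).

Definition disc_continuous phi : Prop := forall u (e : R), 0 < e ->
  exists2 h : R, 0 < h & forall u', cabs (val u' - val u) < h ->
    cabs (val (phi u') - val (phi u)) < e.

Lemma disc_pointP (z : R[i]) : cabs z < 1 -> exists u, val u = z.
Proof. by move=> z1; exists (exist _ z z1). Qed.

(** The intermediate value theorem on the radius that ends at [u].  The bound on
    [u'] keeps the points found for different [y] in one compact disc. *)
Lemma modulus_ivt phi (o u : disc R) (y : R) : disc_continuous phi ->
  val o = 0 -> cabs (val (phi o)) <= y <= cabs (val (phi u)) ->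
  exists2 u', cabs (val u') <= cabs (val u) & cabs (val (phi u')) = y.
Proof.
move=> cphi o0 /andP[yl yr]; have u1 : cabs (val u) < 1 := valP u.
pose pt (t : R) : disc R := insubd u (t%:C%C * val u).
have ptE t : `|t| * cabs (val u) < 1 -> val (pt t) = t%:C%C * val u.
  by move=> tu; rewrite insubdK // unfold_in cabsM cabs_real.
have tu t : t \in `[0, 1] -> `|t| * cabs (val u) <= cabs (val u).
  by rewrite in_itv /= => /andP[t0 t1]; rewrite ger0_norm // ler_piMl ?cabs_ge0.
have tu1 t : t \in `[0, 1] -> `|t| * cabs (val u) < 1.
  by move=> /tu h; exact: le_lt_trans u1.
pose g t := cabs (val (phi (pt t))).
have g0 : g 0 = cabs (val (phi o)).
  by congr (cabs (val (phi _))); apply: val_inj; rewrite ptE ?mul0r ?normr0 ?mul0r.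
have g1 : g 1 = cabs (val (phi u)).
  by congr (cabs (val (phi _))); apply: val_inj; rewrite ptE ?mul1r ?normr1 ?mul1r.
have cg : {within `[0, 1], continuous g}.
  apply: continuous_in_subspaceT => t; rewrite inE /= => t01.
  have t1 := tu1 _ t01.
  apply/cvgrPdist_lt => e e0; have [h h0 hphi] := cphi (pt t) _ e0.
  have d0 : 0 < Num.min h (1 - `|t| * cabs (val u)) by rewrite lt_min h0 subr_gt0.
  apply: filterS (nbhsx_ballx t _ d0) => t' /=.
  rewrite -ball_normE /= lt_min => /andP[th t1'].
  have c0 := cabs_ge0 (val u).
  have dist : `|t' - t| * cabs (val u) <= `|t - t'|.
    by rewrite distrC ler_piMr // ltW.
  have tt' : `|t'| * cabs (val u) < 1.
    rewrite -[t'](subrK t) (le_lt_trans (ler_wpM2r c0 (ler_normD _ _))) //.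
    by rewrite mulrDl -ltrBrDr (le_lt_trans dist).
  rewrite distrC (le_lt_trans (cabs_ler_dist _ _)) // hphi // !ptE //.
  by rewrite -mulrBl cabsM -rmorphB cabs_real (le_lt_trans dist).
have [|t t01 gt] := @IVT R g 0 1 y ler01 cg.
  by rewrite g0 g1 ge_min le_max yl yr orbT.
exists (pt t); last exact: gt.
by rewrite ptE ?tu1 // cabsM cabs_real tu.
Qed.

Lemma tau_dist (q : R) i l : 0 < q < 1 ->
  `|q ^+ i - q ^+ l| / (q ^+ i + q ^+ l) = tau q ((l - i) + (i - l))%N.
Proof.
move=> /andP[q0 q1].
wlog il : i l / (i <= l)%N => [hw|].
  have [/hw//|/ltnW/hw] := leqP i l.
  by rewrite distrC (addrC (q ^+ l)) (addnC (i - l)%N).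
rewrite (eqP il) addn0; have -> : q ^+ l = q ^+ i * q ^+ (l - i).
  by rewrite -exprD subnKC.
have qi : 0 < q ^+ i by rewrite exprn_gt0.
have qli : 0 <= 1 - q ^+ (l - i) by rewrite subr_ge0 exprn_ile1 // ltW.
rewrite -{1 3}(mulr1 (q ^+ i)) -mulrBr -mulrDr.
rewrite ger0_norm ?(mulr_ge0 (ltW qi)) //.
by rewrite invfM mulrACA divff ?gt_eqF // mul1r.
Qed.

(** The images of the nodes lie on the circles of radii [1 - x q ^+ l], where
    [q ^+ s = 1 / 4], and the functions are the normalized Blaschke products of
    these images.  While [p] is fixed and the block length [s] grows, the radii
    stay in a fixed compact interval, which gives [r]; the norms are exponential
    in [s], not in the number [p * s] of nodes. *)
Lemma disc_nodes phi (p : nat) : disc_continuous phi -> sup_norm phi = 1 ->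
  (0 < p)%N -> exists2 r : R, 0 <= r < 1 & forall s, (0 < s)%N ->
  exists (u : 'I_(p * s) -> disc R) (f : 'I_(p * s) -> R[i] -> R[i]),
    [/\ forall l, cabs (val (u l)) <= r,
        forall i, h2_disc (f i) ((64 * expR 1) ^+ (4 * s)) &
        forall i l, f i (val (phi (u l))) = (i == l)%:R].
Proof.
move=> cphi phi1 p0; have [b b0] : exists b : disc R, val b = 0.
  by apply: disc_pointP; rewrite cabs0.
pose x := 1 - cabs (val (phi b)).
have x0 : 0 < x by rewrite subr_gt0; exact: (valP (phi b)).
have [u1 u1P] : exists u1, 1 - x * 4 ^- p < cabs (val (phi u1)).
  have sphi : has_sup (range (fun z => cabs (val (phi z)))).
    split; first by exists (cabs (val (phi b))), b.
    by exists 1 => _ [z _ <-]; apply: ltW; exact: (valP (phi z)).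
  have e0 : 0 < x * 4 ^- p by rewrite mulr_gt0 // invr_gt0 exprn_gt0.
  have [_ [z _ <-] hz] := sup_adherent e0 sphi.
  by exists z; move: hz; rewrite -/(sup_norm phi) phi1.
exists (cabs (val u1)); first by rewrite cabs_ge0; exact: (valP u1).
move=> s s0; pose q : R := expR (- ln 4 / s%:R).
have sR : s%:R != 0 :> R by rewrite pnatr_eq0 -lt0n.
have qs : q ^+ s = 4^-1.
  by rewrite /q -expRM_natr divfK // expRN lnK // posrE.
have q0 : 0 < q := expR_gt0 _.
have q1 : q < 1.
  rewrite -[X in _ < X](expR0 R) ltr_expR mulNr oppr_lt0 divr_gt0 ?ltr0n //.
  by rewrite ln_gt0 // ltr1n.
have q01 : 0 < q < 1 by rewrite q0 q1.
have /boolp.choice[u hu] (l : 'I_(p * s)) : exists u : disc R,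
    cabs (val u) <= cabs (val u1) /\ cabs (val (phi u)) = 1 - x * q ^+ l.
  have ql1 : q ^+ l <= 1 by rewrite exprn_ile1 // ltW.
  have qlp : 4 ^- p <= q ^+ l.
    by rewrite -exprVn -qs -exprM mulnC ler_wiXn2l ?ltW // ltnW.
  have [|u ul uE] := @modulus_ivt phi b u1 (1 - x * q ^+ l) cphi b0.
    apply/andP; split; first by rewrite lerBrDr -lerBrDl -/x ler_piMr // ltW.
    by rewrite (le_trans _ (ltW u1P)) // lerD2l lerN2 ler_wpM2l // ltW.
  by exists u.
pose v l := val (phi (u l)).
have v1 l : cabs (v l) < 1 := valP (phi (u l)).
pose D i := \prod_(l < p * s | l != i) blaschke (v l) (v i).
have DE i : (64 * expR 1) ^- (2 * s) <= cabs (D i).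
  apply: (@le_trans _ _ (\prod_(l < p * s | l != i) tau q ((l - i) + (i - l))%N)).
    apply: le_trans (prod_dist_ge _ (fun k => tau_ge0_le1 k q01)).
    rewrite mulnC exprM -exprVn lerXn2r ?nnegrE ?invr_ge0 ?exprn_ge0 ?mulr_ge0
      ?expR_ge0 //.
      by rewrite prodr_ge0 // => k _; case/andP: (tau_ge0_le1 k.+1 q01).
    exact: prod_tau_ge.
  rewrite /D cabs_prod; apply: ler_prod => l _.
  have [t0 _] := andP (tau_ge0_le1 (l - i + (i - l))%N q01); rewrite t0 /=.
  apply: le_trans (cabs_blaschke_ge (v1 l) (v1 i)).
  have [_ ->] := hu l; have [_ ->] := hu i.
  have -> : 1 - x * q ^+ l - (1 - x * q ^+ i) = x * (q ^+ i - q ^+ l) by ring.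
  have -> : 2 - (1 - x * q ^+ l) - (1 - x * q ^+ i) = x * (q ^+ i + q ^+ l) by ring.
  rewrite normrM (gtr0_norm x0) invfM mulrACA divff ?gt_eqF // mul1r.
  by rewrite tau_dist.
have c0 : 0 < (64 * expR 1) ^- (2 * s) :> R.
  by rewrite invr_gt0 exprn_gt0 // mulr_gt0 // expR_gt0.
have D0 i : D i != 0 by rewrite -cabs_gt0 (lt_le_trans c0).
exists u, (fun i z => (D i)^-1 * \prod_(l < p * s | l != i) blaschke (v l) z).
split=> [l|i|i l]; first by have [] := hu l.
  apply: h2_disc_le (h2_discZ (D i)^-1 (h2_disc_blaschke_prod _ _ v1)).
  rewrite mulr1 cabsV -[X in (4 * X)%N]muln1 (_ : 4 * (s * 1) = 2 * s * 2)%N; last by lia.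
  rewrite exprM lerXn2r ?nnegrE ?invr_ge0 ?cabs_ge0 ?exprn_ge0 ?mulr_ge0 ?expR_ge0 //.
  by rewrite -[leRHS]invrK lef_pV2 ?posrE // cabs_gt0.
case: (eqVneq i l) => [<-|il]; first by rewrite mulVf.
rewrite (bigD1 l) 1?eq_sym //= /blaschke subrr !mul0r mulr0.
by [].
Qed.

End DiscNodes.

(** * Grids of roots of unity and the Baire theorem *)

Section GridNodes.
Variable R : realType.

Lemma h2_disc_geometric (b c : R[i]) M : cabs c <= 1 ->
  h2_disc (fun z => \sum_(k < M) (b * (z - c)) ^+ k) ((2 + 8 * cabs b ^+ 2) ^+ M).
Proof.
move=> c1; set D := 2 + 8 * cabs b ^+ 2.
have D1 : 1 <= D by have := sqr_ge0 (cabs b); rewrite /D; lra.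
elim: M => [|M IH].
  apply: (@h2_disc_ext _ (fun z => 0 * 1)) => [z _|].
    by rewrite big_ord0 mul0r.
  apply: h2_disc_le (h2_discZ 0 (h2_disc1 R)).
  by rewrite cabs0 expr0n mul0r.
apply: h2_disc_ext (h2_disc_le _ (h2_discD (h2_disc1 R)
  (h2_discZ b (h2_discD (h2_discX IH) (h2_discZ (- c) IH))))) => [z _|].
  rewrite big_ord_recl expr0 -mulrDl mulrA mulr_sumr.
  by congr (_ + _); apply: eq_bigr => k _; rewrite -exprS.
have DM : 1 <= D ^+ M by rewrite exprn_ege1.
have c2 : cabs (- c) ^+ 2 <= 1 by rewrite cabsN expr_le1 ?cabs_ge0.
have b2 := sqr_ge0 (cabs b).
have -> : D ^+ M.+1 = 2 * D ^+ M + 8 * (cabs b ^+ 2 * D ^+ M).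
  by rewrite (exprS D M) {1}/D; ring.
have : cabs b ^+ 2 * (2 * D ^+ M + 2 * (cabs (- c) ^+ 2 * D ^+ M)) <=
    cabs b ^+ 2 * (4 * D ^+ M).
  by rewrite ler_wpM2l //; nra.
lra.
Qed.

Lemma cvg_geometric_sum (u : nat -> R[i]) (s b c : R[i]) M : u @ \oo --> s ->
  (fun n => \sum_(k < M) (b * (u n - c)) ^+ k) @ \oo -->
    \sum_(k < M) (b * (s - c)) ^+ k.
Proof.
move=> us; elim: M => [|M IH].
  by rewrite big_ord0; apply: eq_cvg_seq (cvg_cst _) => n; rewrite big_ord0.
have recE (x : R[i]) : \sum_(k < M.+1) x ^+ k = 1 + x * \sum_(k < M) x ^+ k.
  rewrite big_ord_recl expr0 mulr_sumr.
  by congr (_ + _); apply: eq_bigr => k _; rewrite -exprS.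
rewrite recE; apply: eq_cvg_seq (fun n => recE (b * (u n - c))) _.
apply: cvgD; first exact: cvg_cst.
apply: cvgM IH; apply: cvgM; first exact: cvg_cst.
by apply: cvgB; [exact: us|exact: cvg_cst].
Qed.

(** Dual systems of product type for the grids [c + h * w], where [w] runs over
    the tuples of [M]-th roots of unity: at such points the geometric sums below
    are [M] or [0].  The points may be moved slightly, into a set which is only
    dense near [c]. *)
Lemma grid_nodes (T : Type) (m : nat) (psi : T -> 'rV[R[i]]_m) (W : set T)
    (c : 'rV[R[i]]_m) (h : R) : 0 < h -> (forall j, cabs (c ord0 j) <= 1) ->
  (forall x : 'rV[R[i]]_m, (forall j, cabs (x ord0 j - c ord0 j) <= h) ->
     forall e : R, 0 < e ->
     exists2 t, W t & forall j, cabs (psi t ord0 j - x ord0 j) < e) ->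
  exists2 D : R, 1 <= D & forall (M : nat) (e : R), (0 < M)%N -> 0 < e ->
  exists (t : {ffun 'I_m -> 'I_M} -> T)
         (g : {ffun 'I_m -> 'I_M} -> 'I_m -> R[i] -> R[i]),
    [/\ forall k, W (t k),
        forall k j, h2_disc (g k j) (D ^+ M) &
        forall k l, cabs (\prod_j g k j (psi (t l) ord0 j) - (k == l)%:R) < e].
Proof.
move=> h0 c1 dense_psi; exists (2 + 8 * h^-1 ^+ 2).
  by have := sqr_ge0 h^-1; lra.
move=> M e M0 e0; have [w hw] := complex_prim_root_exists R M0.
have wM : w ^+ M = 1 := prim_expr_order hw.
have w1 : cabs w = 1 := cabs_unity_root M0 wM.
have w0 : w != 0 by rewrite -cabs_gt0 w1.
have M0' : M%:R != 0 :> R[i] by rewrite pnatr_eq0 -lt0n.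
have hC : h%:C%C != 0 by rewrite -cabs_gt0 cabs_real normr_gt0 gt_eqF.
pose x (l : {ffun 'I_m -> 'I_M}) : 'rV[R[i]]_m :=
  \row_j (c ord0 j + h%:C%C * w ^+ l j).
pose b (k : {ffun 'I_m -> 'I_M}) j : R[i] := w ^- k j / h%:C%C.
pose g (k : {ffun 'I_m -> 'I_M}) j (z : R[i]) : R[i] :=
  M%:R^-1 * \sum_(i < M) (b k j * (z - c ord0 j)) ^+ i.
have gx k l : \prod_j g k j (x l ord0 j) = (k == l)%:R.
  have E j : g k j (x l ord0 j) = (k j == l j)%:R.
    rewrite /g mxE addrAC subrr add0r /b -mulrA mulKf //.
    rewrite sum_unity_root; last first.
      by rewrite exprMn exprVn -!exprM !(mulnC _ M) !exprM wM !expr1n invr1 mulr1.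
    have -> : (w ^- k j * w ^+ l j == 1) = (k j == l j).
      rewrite -(inj_eq (mulfI (expf_neq0 (k j) w0))) mulr1 mulVKf ?expf_neq0 //.
      by rewrite (eq_prim_root_expr hw) !modn_small // eq_sym.
    by case: ifP => _; rewrite ?mulr0 ?mulVf.
  under eq_bigr do rewrite E.
  case: eqP => [->|kl]; first by rewrite big1 // => j _; rewrite eqxx.
  have [j kj] : exists j, k j != l j.
    apply/existsP; rewrite -negb_forall; apply/negP => /forallP h1.
    by apply: kl; apply/ffunP => j; apply/eqP.
  by rewrite (bigD1 j) //= (negbTE kj) mul0r.
have near_x l : exists t, W t /\ forall k,
    cabs (\prod_j g k j (psi t ord0 j) - (k == l)%:R) < e.
  have xl j : cabs (x l ord0 j - c ord0 j) <= h.
    rewrite mxE addrAC subrr add0r cabsM cabsX w1 expr1n mulr1 cabs_real.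
    by rewrite gtr0_norm.
  have /boolp.choice[t ht] (n : nat) : exists t, W t /\
      forall j, cabs (psi t ord0 j - x l ord0 j) < n.+1%:R^-1.
    have n0 : 0 < n.+1%:R^-1 :> R by rewrite invr_gt0.
    by have [t Wt ht] := dense_psi _ xl _ n0; exists t.
  have tx j : (fun n => psi (t n) ord0 j) @ \oo --> x l ord0 j.
    apply: cabs_cvg0; apply: squeeze_cvgr (cvg_cst 0) (@cvg_harmonic R).
    by apply: nearW => n; rewrite cabs_ge0 /= ltW //; have [_] := ht n.
  have gt k : \forall n \near \oo,
      cabs (\prod_j g k j (psi (t n) ord0 j) - (k == l)%:R) < e.
    apply: cvg_cabs_lt => //; rewrite -gx.
    apply: cvg_prodr => j; apply: cvgM; first exact: cvg_cst.
    exact: cvg_geometric_sum.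
  have [n _ hn] := filter_forall _ gt.
  by exists (t n); split=> [|k]; [have [] := ht n|exact: (hn n (leqnn n) k)].
have /boolp.choice[t ht] := near_x.
exists t, g; split=> [k|k j|k l]; first by have [] := ht k.
- apply: h2_disc_le (h2_discZ _ (h2_disc_geometric (b k j) M (c1 j))).
  rewrite /b cabsM !cabsV cabsX w1 expr1n invr1 mul1r cabs_real gtr0_norm //.
  rewrite ler_piMl ?exprn_ge0 //; first by have := sqr_ge0 h^-1; lra.
  by rewrite expr_le1 ?invr_ge0 ?cabs_ge0 // cabs_nat invf_le1 ?ler1n ?ltr0n.
- by have [] := ht l.
Qed.

(** This is the Baire theorem in the space of the real 2 by [m] matrices of real and
    imaginary parts, applied to the complements of the closures. *)
Lemma cover_dense_somewhere (m : nat) (E : nat -> set 'rV[R[i]]_m)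
    (a : 'rV[R[i]]_m) (e : R) : 0 < e ->
  (forall x : 'rV[R[i]]_m, (forall j, cabs (x ord0 j - a ord0 j) < e) ->
     exists n, E n x) ->
  exists n (c : 'rV[R[i]]_m), exists2 h : R, 0 < h &
    forall x : 'rV[R[i]]_m, (forall j, cabs (x ord0 j - c ord0 j) <= h) ->
    forall e' : R, 0 < e' ->
    exists2 y, E n y & forall j, cabs (y ord0 j - x ord0 j) < e'.
Proof.
move=> e0 cover.
pose toC (X : 'M[R]_(2, m)) : 'rV[R[i]]_m := \row_j (X ord0 j +i* X ord_max j)%C.
have toC_dist X Y (d : R) j : ball X (d / 2) Y ->
    cabs (toC Y ord0 j - toC X ord0 j) < d.
  move=> XY; rewrite cabsC !mxE.
  have -> : (X ord0 j +i* X ord_max j - (Y ord0 j +i* Y ord_max j))%C =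
      (X ord0 j - Y ord0 j)%:C%C + (X ord_max j - Y ord_max j)%:C%C * 'i%C.
    by simpc.
  rewrite (le_lt_trans (cabsD _ _)) // (splitr d) cabsM !cabs_real.
  have -> : cabs ('i%C : R[i]) = 1.
    by rewrite /ComplexField.Normc.normc /= expr0n expr1n add0r sqrtr1.
  have [_ XY'] := XY; have := XY' ord0 j; have := XY' ord_max j.
  rewrite -!ball_normE /= => h1 h0.
  by rewrite mulr1 ltrD.
pose fromC (x : 'rV[R[i]]_m) : 'M[R]_(2, m) :=
  \matrix_(i, j) (if i == ord0 then complex.Re (x ord0 j) else complex.Im (x ord0 j)).
have fromCK x : toC (fromC x) = x.
  apply/rowP => j; rewrite !mxE /=; case: (x ord0 j) => u v //.
have fromC_dist X (x : 'rV[R[i]]_m) (d : R) : 0 < d -> (forall j, cabs (x ord0 j - toC X ord0 j) < d) ->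
    ball X d (fromC x).
  move=> d0 Xx; split=> // i j; have := Xx j; rewrite !mxE -ball_normE /=.
  rewrite distrC; apply: le_lt_trans.
  have part (z : R[i]) : `|complex.Re z| <= cabs z /\ `|complex.Im z| <= cabs z.
    case: z => u v; rewrite /ComplexField.Normc.normc /= -(sqrtr_sqr u) -(sqrtr_sqr v).
    by rewrite !ler_sqrt ?addr_ge0 ?sqr_ge0 // lerDl lerDr !sqr_ge0.
  case: ifPn => [/eqP ->|i0].
    by have [+ _] := part (x ord0 j - (X ord0 j +i* X ord_max j)%C);
      case: (x ord0 j).
  have -> : i = ord_max by apply: val_inj; case: i i0 => [[|[]]].
  by have [_] := part (x ord0 j - (X ord0 j +i* X ord_max j)%C);
    case: (x ord0 j).
pose A n := [set X | E n (toC X)].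
have [n /existsNP[V /not_implyP[[X VX] /not_implyP[oV hV]]]] :
    exists n, ~ dense (~` closure (A n)).
  apply/existsNP => all_dense.
  have od n : open (~` closure (A n)) /\ dense (~` closure (A n)).
    by split; [rewrite openC; exact: closed_closure|exact: all_dense].
  have e20 : 0 < e / 2 by rewrite divr_gt0.
  have /(_ (ball (fromC a) (e / 2))) := Baire od.
  case=> [||Y [aY hY]].
  - by exists (fromC a); exact: ballxx.
  - exact: ball_open.
  have Ya j : cabs (toC Y ord0 j - a ord0 j) < e.
    by rewrite -[in X in _ - X](fromCK a); exact: toC_dist.
  have [n En] := cover (toC Y) Ya.
  by apply: (hY n I); exact: subset_closure.
have subV : V `<=` closure (A n).
  by move=> Y VY; apply: contrapT => nY; apply: hV; exists Y.
have /nbhs_ballP[d /= d0 dV] : nbhs X V by exact: open_nbhs_nbhs.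
exists n, (toC X), (d / 2); first by rewrite divr_gt0.
move=> x xX e' e'0.
have /subV clx : V (fromC x).
  apply: dV; apply: fromC_dist => // j; rewrite (le_lt_trans (xX j)) //.
  by rewrite ltr_pdivrMr // ltr_pMr // ltr1n.
have e'20 : 0 < e' / 2 by rewrite divr_gt0.
have [Y [AY xY]] := clx _ (nbhsx_ballx (fromC x) _ e'20).
exists (toC Y) => // j; rewrite -[in X in _ - X](fromCK x); exact: toC_dist.
Qed.

End GridNodes.

(** * Limits of roots *)

Section RootLimit.
Variable R : realType.
Implicit Types (a : nat -> R) (K x y : R).

Lemma geometric_dominates K x y : 0 < K -> 0 < x -> x < y ->
  \forall n \near \oo, K * x ^+ n <= y ^+ n.
Proof.
move=> K0 x0 xy; have y0 := lt_trans x0 xy.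
have xy1 : `|x / y| < 1.
  by rewrite ger0_norm ?divr_ge0 ?(ltW x0) ?(ltW y0) // ltr_pdivrMr ?mul1r.
have K0' : 0 < K^-1 by rewrite invr_gt0.
have /cvgrPdist_lt/(_ _ K0') := cvg_expr xy1.
apply: filterS => n; rewrite sub0r normrN ger0_norm ?exprn_ge0 ?divr_ge0 ?(ltW x0) ?(ltW y0) //.
rewrite exprMn exprVn => /ltW; rewrite ler_pdivrMr ?exprn_gt0 // mulrC.
by rewrite ler_pdivlMr // mulrC.
Qed.

(** [n]-th roots do not see bounded factors, nor the [n %/ k]-th powers of a
    constant when [k] is large. *)
Lemma root_limit1 a (A D : R) : 1 <= D -> (forall n, (0 < n)%N -> a n <= A) ->
  (forall k, (0 < k)%N -> exists2 c : R, 0 < c &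
     forall n, (0 < n)%N -> c * D ^- (n %/ k) <= a n) ->
  (fun n => a n `^ n%:R^-1) @ \oo --> (1 : R).
Proof.
move=> D1 aA alow.
have a0 n : (0 < n)%N -> 0 < a n.
  move=> n0; have [c c0 hc] := alow _ (ltn0Sn 0).
  apply: lt_le_trans (hc _ n0).
  by rewrite mulr_gt0 // invr_gt0 exprn_gt0 // (lt_le_trans ltr01).
have A0 : 0 < A by rewrite (lt_le_trans (a0 1%N isT)) ?aA.
apply/cvgrPdist_le => e0 e00.
pose e := Num.min e0 2^-1.
have e_gt0 : 0 < e by rewrite lt_min e00 invr_gt0 ltr0n.
have e_le : e <= e0 by rewrite ge_min lexx.
have e2 : e <= 2^-1 by rewrite ge_min lexx orbT.
have D0 : 0 < D by rewrite (lt_le_trans ltr01).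
have x1 : 0 < 1 - e / 2 by lra.
have x2 : 1 - e / 2 <= 1 by lra.
have y1 : 0 < 1 - e by lra.
have y2 : 0 < 1 + e by lra.
have [k _ hk] : \forall k \near \oo, D * (1 - e / 2) ^+ k <= 1 ^+ k.
  by apply: geometric_dominates => //; lra.
have [c c0 hc] := alow _ (ltn0Sn k).
have Dk : (1 - e / 2) ^+ k.+1 <= D^-1.
  rewrite -[leRHS]mul1r ler_pdivlMr // mulrC.
  by have := hk k.+1 (leqnSn k); rewrite expr1n.
have root x n : (0 < n)%N -> 0 < x -> x = (x ^+ n) `^ n%:R^-1.
  move=> n0 x0; rewrite -powR_mulrn ?ltW // -powRrM divff ?powRr1 ?ltW //.
  by rewrite pnatr_eq0 -lt0n.
near=> n.
have n0 : (0 < n)%N by near: n; exists 1%N.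
have n0' : 0 <= n%:R^-1 :> R by rewrite invr_ge0.
have upper : a n <= (1 + e) ^+ n.
  apply: (@le_trans _ _ (A * 1 ^+ n)); first by rewrite expr1n mulr1 aA.
  by near: n; apply: geometric_dominates => //; lra.
have lower : (1 - e) ^+ n <= a n.
  apply: le_trans (hc n n0).
  apply: (@le_trans _ _ (c * (1 - e / 2) ^+ n)).
    rewrite mulrC -ler_pdivrMr // mulrC.
    by near: n; apply: geometric_dominates; rewrite ?invr_gt0 //; lra.
  rewrite ler_pM2l // -exprVn.
  apply: (@le_trans _ _ (((1 - e / 2) ^+ k.+1) ^+ (n %/ k.+1))).
    rewrite -exprM ler_wiXn2l ?(ltW x1) //.
    by rewrite mulnC leq_trunc_div.
  by rewrite lerXn2r ?nnegrE ?exprn_ge0 ?invr_ge0 ?(ltW D0) ?(ltW x1).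
rewrite ler_distlC; apply/andP; split.
  apply: (@le_trans _ _ (1 - e)); first by rewrite lerD2l lerN2.
  rewrite [leLHS](root (1 - e) n n0 y1).
  by rewrite ge0_ler_powR ?nnegrE ?exprn_ge0 ?(ltW (a0 n n0)) ?(ltW y1).
apply: (@le_trans _ _ (1 + e)); last by rewrite lerD2l.
rewrite [leRHS](root (1 + e) n n0 y2).
by rewrite ge0_ler_powR ?nnegrE ?exprn_ge0 ?(ltW (a0 n n0)) ?(ltW y2).
Unshelve. all: by end_near. Qed.

End RootLimit.

(** * Split symbols *)

Section SplitSymbol.
Variables (R : realType) (m : nat).
Implicit Types (u : disc R) (v : polydisc R m).

Lemma pcons0 u v : val (pcons u v) ord0 ord0 = val u.
Proof. by rewrite /= /pcons_row mxE; case: splitP => k // _; rewrite mxE. Qed.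

Lemma pconsS u v j : val (pcons u v) ord0 (lift ord0 j) = val v ord0 j.
Proof.
rewrite /= /pcons_row mxE; case: splitP => k /= jk.
  by have := ltn_ord k; rewrite -jk.
by congr (val v _ _); apply: val_inj; move: jk; rewrite /= /bump add1n => -[].
Qed.

Lemma pcons_surj (z : polydisc R m.+1) : exists u v, z = pcons u v.
Proof.
have z1 j : cabs (val z ord0 j) < 1 by have /forallP := valP z; apply.
have [u uE] := disc_pointP (z1 ord0).
have [|v vE] := @polydisc_pointP R m (\row_j val z ord0 (lift ord0 j)).
  by move=> j; rewrite mxE.
exists u, v; apply: val_inj; apply/rowP => j.
case: (unliftP ord0 j) => [i ->|->]; last by rewrite pcons0.
by rewrite pconsS vE mxE.
Qed.

Variables (Phi : polydisc R m.+1 -> polydisc R m.+1).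
Variables (phi : disc R -> disc R) (psi : polydisc R m -> polydisc R m).
Hypothesis Phi_split : forall u v, Phi (pcons u v) = pcons (phi u) (psi v).

Lemma split_disc_continuous : analytic_map Phi -> disc_continuous phi.
Proof.
move=> holPhi u e e0.
have [v vE] : exists v : polydisc R m, val v = 0.
  by apply: polydisc_pointP => j; rewrite mxE cabs0.
have := differentiable_continuous (holPhi ord0 (pcons u v)).
have extE w : extend0 (fun z => val (Phi z) ord0 ord0) (val (pcons w v)) =
    val (phi w).
  by rewrite /extend0 valK Phi_split pcons0.
move=> /cvgrPdist_lt; rewrite extE => /(_ e%:C%C).
rewrite ltcR => /(_ e0)/nbhs_ballP[d /= d0 hd].
have dE : d = (complex.Re d)%:C%C by rewrite RRe_real // gtr0_real.
exists (complex.Re d); first by rewrite -ltcR -dE.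
move=> u' uu'; rewrite cabsC -ltr_cabs -[val (phi u')]extE; apply: hd.
split=> // i j; rewrite (ord1 i) -ball_normE /=.
case: (unliftP ord0 j) => [l ->|->]; last first.
  by rewrite !pcons0 dE distrC ltr_cabs.
by rewrite !pconsS subrr normr0.
Qed.

(** Some compact part of the polydisc has an image which is dense near some
    point, because countably many such parts exhaust the polydisc. *)
Lemma split_dense_image : truly_dimensional Phi ->
  exists2 r : R, 0 <= r < 1 & exists (c : 'rV[R[i]]_m) (h : R),
    [/\ 0 < h, forall j, cabs (c ord0 j) <= 1 &
     forall x : 'rV[R[i]]_m, (forall j, cabs (x ord0 j - c ord0 j) <= h) ->
     forall e : R, 0 < e ->
     exists2 w : polydisc R m, forall j, cabs (val w ord0 j) <= r &
       forall j, cabs (val (psi w) ord0 j - x ord0 j) < e].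
Proof.
move=> [z0 /nbhs_ballP[d /= d0 hd]].
have dE : d = (complex.Re d)%:C%C by rewrite RRe_real // gtr0_real.
have Re0 : 0 < complex.Re d by rewrite -ltcR -dE.
pose a : 'rV[R[i]]_m := \row_j z0 ord0 (lift ord0 j).
have image (x : 'rV[R[i]]_m) : (forall j, cabs (x ord0 j - a ord0 j) < complex.Re d) ->
    exists w : polydisc R m, val (psi w) = x.
  move=> xa; pose y : 'rV[R[i]]_m.+1 :=
    \row_j (if unlift ord0 j is Some i then x ord0 i else z0 ord0 ord0).
  have [|z _ zy] := hd y.
    split=> // i j; rewrite (ord1 i) -ball_normE /= mxE.
    case: unliftP => [l ->|->]; last by rewrite subrr normr0.
    by have := xa l; rewrite mxE dE ltr_cabs cabsC.
  have [u [v zE]] := pcons_surj z; exists v; apply/rowP => j.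
  have := congr1 (fun y : 'rV[R[i]]_m.+1 => y ord0 (lift ord0 j)) zy.
  by rewrite zE Phi_split /= -/(val (pcons _ _)) pconsS mxE liftK.
pose rad n : R := 1 - n.+1%:R^-1.
pose W n := [set w : polydisc R m | forall j, cabs (val w ord0 j) <= rad n].
pose E n : set 'rV[R[i]]_m := [set val (psi w) | w in W n].
have [|n [c [h h0 hE]]] := @cover_dense_somewhere R m E a _ Re0.
  move=> x /image[w wx].
  have w1 j : 0 < 1 - cabs (val w ord0 j).
    by rewrite subr_gt0; have /forallP := valP w; apply.
  exists (\max_j Num.bound (1 - cabs (val w ord0 j))^-1)%N, w => // j.
  rewrite /rad lerBrDr -lerBrDl -[leRHS]invrK lef_pV2 ?posrE ?invr_gt0 //.
  have t0 : 0 <= (1 - cabs (val w ord0 j))^-1 by rewrite invr_ge0 ltW.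
  rewrite (le_trans (ltW (archi_boundP t0))) // ler_nat leqW //.
  exact: (leq_bigmax (F := fun j => Num.bound (1 - cabs (val w ord0 j))^-1)).
exists (rad n).
  by rewrite /rad subr_ge0 invf_le1 ?ler1n ?ltr0n //= ltrBlDr ltrDl invr_gt0.
exists c, h; split=> // [j|x xc e e0].
  apply/ler_addgt0Pr => e e0.
  have [|_ [w _ <-] hw] := hE c _ _ e0.
    by move=> l; rewrite subrr cabs0 ltW.
  have w1 : cabs (val (psi w) ord0 j) < 1.
    by have /forallP := valP (psi w); apply.
  rewrite -[c ord0 j](subKr (val (psi w) ord0 j)) (le_trans (cabsB _ _)) //.
  by rewrite lerD // ltW.
by have [_ [w Ww <-] hw] := hE x xc _ e0; exists w.
Qed.

End SplitSymbol.

Section MainBound.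
Variables (R : realType) (m : nat).
Variables (Phi : polydisc R m.+1 -> polydisc R m.+1).
Variables (phi : disc R -> disc R) (psi : polydisc R m -> polydisc R m).
Hypothesis Phi_split : forall u v, Phi (pcons u v) = pcons (phi u) (psi v).

Local Notation hardy := (@hardy R m.+1).
Local Notation norm := (@hardy_norm R m.+1).

(** With [M = n %/ k + 1], there are [k ^ m.+1 * M] nodes in the disc and [M ^ m]
    nodes in the polydisc of dimension [m], hence at least [n ^ m.+1] in all,
    while the norms of the test functions are exponential in [M] only. *)
Lemma approx_num_split_ge : is_symbol Phi -> truly_dimensional Phi ->
  sup_norm phi = 1 ->
  exists2 D : R, 1 <= D & forall k, (0 < k)%N -> exists2 c : R, 0 < c &
    forall n, (0 < n)%N ->
      c * D ^- (n %/ k) <= approx_num hardy norm (comp_op Phi) (n ^ m.+1).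
Proof.
move=> [holPhi bPhi] dimPhi phi1.
have cphi := split_disc_continuous Phi_split holPhi.
have [r1 /andP[r10 r11] [c0 [h [h0 c01 dense]]]] := split_dense_image Phi_split dimPhi.
have [D0 D01 grid] := grid_nodes (psi := fun w : polydisc R m => val (psi w))
  (W := [set w : polydisc R m | forall j, cabs (val w ord0 j) <= r1]) h0 c01 dense.
pose B : R := (64 * expR 1) ^+ 4 * D0 ^+ m.
have e1 : 1 <= expR 1 :> R by rewrite -[X in X <= _]expR0 ler_expR.
have B1 : 1 <= B by rewrite mulr_ege1 // exprn_ege1 //; lra.
exists (B * 2 ^+ m.+1); first by rewrite mulr_ege1 // exprn_ege1 // ler1n.
move=> k k0; pose p := (k ^ m.+1)%N.
have p0 : (0 < p)%N by rewrite expn_gt0 k0.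
have [r2 /andP[r20 r21] nodes] := disc_nodes cphi phi1 p0.
pose r := Num.max r1 r2.
have r01 : 0 <= r < 1 by rewrite le_max r10 /= gt_max r11.
pose K : R := 1 + (1 - r ^+ 2) ^- m.+1.
have K0 : 0 < K.
  rewrite ltr_pwDl // invr_ge0 exprn_ge0 // subr_ge0.
  by case/andP: r01 => ? ?; rewrite expr_le1 // ltW.
have pR : 0 < p%:R :> R by rewrite ltr0n.
have B0 : 0 < B := lt_le_trans ltr01 B1.
have D20 : 0 < B * 2 ^+ m.+1 by rewrite mulr_gt0 // exprn_gt0.
exists ((2 * p%:R * K * (B * 2 ^+ m.+1))^-1).
  by rewrite invr_gt0; apply: mulr_gt0 (mulr_gt0 (mulr_gt0 _ pR) K0) D20.
move=> n n0; pose M := (n %/ k).+1.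
have [u [f [ur fH fd]]] := nodes M (ltn0Sn _).
pose I := ('I_(p * M) * {ffun 'I_m -> 'I_M})%type.
have cardI : #|{: I}| = (p * M ^ m.+1)%N.
  by rewrite card_prod card_ffun !card_ord expnS mulnA.
have nI : (n ^ m.+1 <= #|{: I}|)%N.
  rewrite cardI -expnMn leq_exp2r // mulnC -ltnS.
  by rewrite (leq_trans (ltn_ceil n k0)) // leqW.
have I0 : (0 < #|{: I}|)%N by rewrite (leq_trans _ nI) // expn_gt0 n0.
have N0 : 0 < (4 * #|{: I}|%:R)^-1 :> R by rewrite invr_gt0 mulr_gt0 // ltr0n.
have [w [g [wr gH gd]]] := grid M _ (ltn0Sn _) N0.
pose z (i : I) : polydisc R m.+1 := pcons (u i.1) (w i.2).
pose F (i : I) (j : 'I_m.+1) : R[i] -> R[i] :=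
  if unlift ord0 j is Some l then g i.2 l else f i.1.
pose G (i : I) (y : polydisc R m.+1) : R[i] := \prod_j F i j (val y ord0 j).
have GE i u' v' : G i (pcons u' v') =
    f i.1 (val u') * \prod_j g i.2 j (val v' ord0 j).
  rewrite /G big_ord_recl /F unlift_none pcons0; congr (_ * _).
  by apply: eq_bigr => j _; rewrite liftK pconsS.
have BM : 1 <= B ^+ M by rewrite exprn_ege1.
have GH i : hardy (G i) /\ norm (G i) <= B ^+ M.
  apply: (@hardy_tensor _ _ (F i) (fun j =>
    if unlift ord0 j is Some _ then D0 ^+ M else (64 * expR 1) ^+ (4 * M))).
  - by move=> j; rewrite /F; case: unliftP.
  - exact: le_trans ler01 BM.
  rewrite big_ord_recl unlift_none; under eq_bigr do rewrite liftK.
  have -> : (64 * expR 1) ^+ (4 * M) * \prod_(j < m) D0 ^+ M = B ^+ M.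
    by rewrite prodr_const card_ord /B [RHS]exprMn -!exprM (mulnC M).
  by rewrite expr2 ler_peMr // (le_trans ler01).
apply: le_trans (approx_num_comp_ge (z := z) (F := G) (r := r) (C := B ^+ M)
  bPhi _ nI r01 _ _ _ _ _); last first.
- move=> i l; rewrite /z Phi_split GE fd.
  case: (eqVneq i.1 l.1) => [il|il].
    rewrite mul1r; have -> : (i == l) = (i.2 == l.2) by rewrite [LHS]xpair_eqE il eqxx.
    exact/ltW/gd.
  by rewrite mul0r [i == l]xpair_eqE (negbTE il) subr0 cabs0 ltW.
- by move=> i; have [] := GH i.
- by move=> i; have [] := GH i.
- move=> l j; rewrite /z; case: (unliftP ord0 j) => [j' ->|->].
    by rewrite pconsS le_max wr.
  by rewrite pcons0 le_max ur orbT.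
- exact: lt_le_trans BM.
- by rewrite expn_gt0 n0.
rewrite -/K cardI -invfM lef_pV2 ?posrE; last 2 first.
- apply: mulr_gt0; last by rewrite exprn_gt0.
  exact: mulr_gt0 (mulr_gt0 (mulr_gt0 _ pR) K0) D20.
- apply: mulr_gt0 K0; apply: mulr_gt0; last exact: lt_le_trans BM.
  by rewrite mulr_gt0 // ltr0n muln_gt0 p0 expn_gt0.
have -> : 2 * p%:R * K * (B * 2 ^+ m.+1) * (B * 2 ^+ m.+1) ^+ (n %/ k) =
    2 * p%:R * (2 ^+ m.+1) ^+ M * B ^+ M * K.
  by rewrite -[LHS]mulrA -exprS -/M exprMn; ring.
rewrite ler_pM2r // ler_pM2r ?exprn_gt0 // natrM mulrA ler_pM2l ?mulr_gt0 //.
rewrite exprAC natrX lerXn2r ?nnegrE ?exprn_ge0 //.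
by rewrite -natrX ler_nat ltnW // ltn_expl.
Qed.

End MainBound.

Unset Implicit Arguments.
Set Strict Implicit.
Set Printing Implicit Defensive.

(* The dimension is d = m.+1 with m >= 1. *)
Theorem theorem3p1 (R : realType) (m : nat) (m_ge1 : (1 <= m)%N)
    (Phi : polydisc R m.+1 -> polydisc R m.+1)
    (phi : disc R -> disc R) (psi : polydisc R m -> polydisc R m)
    (Phi_symbol : is_symbol Phi)
    (Phi_dim : truly_dimensional Phi)
    (Phi_split : forall (u : disc R) (v : polydisc R m),
       Phi (pcons u v) = pcons (phi u) (psi v))
    (phi_sup : sup_norm phi = 1) :
  [/\ beta_minus (@hardy R m.+1) (@hardy_norm R m.+1) m.+1 (comp_op Phi)
        = 1%:E,
      beta_plus (@hardy R m.+1) (@hardy_norm R m.+1) m.+1 (comp_op Phi)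
        = 1%:E &
      beta_seq (@hardy R m.+1) (@hardy_norm R m.+1) m.+1 (comp_op Phi) n
        @[n --> \oo] --> (1 : R)].

Proof.
have [_ [_ _ [M TM]]] := Phi_symbol.
have [D D1 lower] := approx_num_split_ge Phi_split Phi_symbol Phi_dim phi_sup.
have lim : beta_seq (@hardy R m.+1) (@hardy_norm R m.+1) m.+1 (comp_op Phi) n
    @[n --> \oo] --> (1 : R).
  apply: (root_limit1 (A := `|M|) D1 _ lower) => n n0.
  apply: approx_num_le => [|//|f hf]; first by rewrite expn_gt0 n0.
  by rewrite (le_trans (TM _ hf)) // ler_wpM2r ?hardy_norm_ge0 ?ler_norm.
have elim : (beta_seq (@hardy R m.+1) (@hardy_norm R m.+1) m.+1 (comp_op Phi) n)%:E
    @[n --> \oo] --> 1%:E.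
  by apply: cvg_EFin; [exact: nearW|exact: lim].
by have [inf_eq sup_eq] := cvg_limn_einf_sup elim.
Qed.
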